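(* Let $S_1,S_2$ be rooted plane trees such that $S_1\subseteq S_2$. Then, with limits taken as $n\to\infty$ through odd values, $$\lim_{n\to\infty}\sqrt{n}\,\frac{g_{\mathcal{B}_n}(S_1)}{a_{\mathcal{B}_n}(S_1)}\le \lim_{n\to\infty}\sqrt{n}\,\frac{g_{\mathcal{B}_n}(S_2)}{a_{\mathcal{B}_n}(S_2)}.$$
   Context: $\mathcal{B}_n$ is the set of plane (ordered) binary trees with $n$ nodes (every node has $0$ or $2$ children, order of children matters); it is empty for even $n$. A rooted tree is viewed as a poset with $v\le w$ iff $w$ is an ancestor of $v$ or equal to it. For incomparable vertices $x,y$ of a plane tree, $x$ is left of $y$ if at their lowest common ancestor the child leading to $x$ precedes the child leading to $y$. A (plane) embedding of a plane tree $S$ into a plane tree $T$ is a vertex subset $E$ of $T$ whose induced subposet is isomorphic to $S$ via an isomorphism preserving the left-to-right order of children of each vertex of $S$; it is good if $E$ contains the root of $T$. $S\subseteq T$ means there is at least one embedding of $S$ into $T$. $a_{\mathcal{B}_n}(S)$ (resp. $g_{\mathcal{B}_n}(S)$) is the total number of embeddings (resp. good embeddings) of $S$ into all trees of $\mathcal{B}_n$. *)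

(* Defs.v *)
From HB Require Import structures.
From mathcomp Require Import all_boot all_order all_algebra.
From mathcomp Require Import finmap.
From mathcomp Require Import all_classical all_reals all_analysis.
Set Implicit Arguments. Unset Strict Implicit. Unset Printing Implicit Defensive.
Import Order.TTheory GRing.Theory Num.Theory.

Inductive ptree := PNode of seq ptree.

(* Vertices of a plane tree, as addresses: the root is [::], and the
   i-th child (0-based, left to right) of vertex v is rcons v i. *)
Fixpoint verts (t : ptree) : seq (seq nat) :=
  match t with
  | PNode ts => [::] :: flatten (map (fun p => map (cons p.1) p.2)
                                     (zip (iota 0 (size ts)) (map verts ts)))
  end.

(* In the poset of a rooted tree, v <= w iff w is an ancestor of v or equal
   to it, i.e. iff the address w is a prefix of the address v. *)
Definition tle (v w : seq nat) : bool := prefix w v.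

(* x is left of y: at their lowest common ancestor p, the child of p leading
   to x (rcons p i) precedes the child leading to y (rcons p j). *)
Definition leftof (x y : seq nat) : Prop :=
  exists (p : seq nat) (i j : nat),
    [/\ i < j, prefix (rcons p i) x & prefix (rcons p j) y].

(* E (a set of vertices of T) is a plane embedding of S into T: there is an
   isomorphism f from the poset of S onto the induced subposet E, which
   preserves the left-to-right order of the children of every vertex of S. *)
Definition is_embedding (S T : ptree) (E : {fset (seq nat)}) : Prop :=
  {subset E <= verts T} /\
  exists f : seq nat -> seq nat,
    [/\ forall v, v \in verts S -> f v \in E,
        forall w, w \in E -> exists2 v, v \in verts S & f v = w,
        forall u v, u \in verts S -> v \in verts S -> tle u v = tle (f u) (f v)
      & forall p i j, rcons p i \in verts S -> rcons p j \in verts S -> i < j ->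
          leftof (f (rcons p i)) (f (rcons p j))].

Definition is_good_embedding (S T : ptree) (E : {fset (seq nat)}) : Prop :=
  is_embedding S T E /\ [::] \in E.

Definition subtree (S T : ptree) : Prop := exists E, is_embedding S T E.

Local Open Scope classical_set_scope.
Local Open Scope ring_scope.

Definition num_emb (S T : ptree) : nat :=
  \sum_(E \in [set E : {fset (seq nat)} | is_embedding S T E]) 1%N.
Definition num_good_emb (S T : ptree) : nat :=
  \sum_(E \in [set E : {fset (seq nat)} | is_good_embedding S T E]) 1%N.

Inductive btree := BLeaf | BNode of btree & btree.

Fixpoint bsize (t : btree) : nat :=
  match t with BLeaf => 1 | BNode l r => (bsize l + bsize r).+1 end.

Fixpoint btoP (t : btree) : ptree :=
  match t with BLeaf => PNode [::] | BNode l r => PNode [:: btoP l; btoP r] end.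

Fixpoint benc (t : btree) : GenTree.tree unit :=
  match t with
  | BLeaf => GenTree.Node 0 [::]
  | BNode l r => GenTree.Node 1 [:: benc l; benc r]
  end.

Fixpoint bdec (t : GenTree.tree unit) : option btree :=
  match t with
  | GenTree.Node 0 [::] => Some BLeaf
  | GenTree.Node 1 [:: a; b] =>
      match bdec a, bdec b with Some l, Some r => Some (BNode l r) | _, _ => None end
  | _ => None
  end.

Lemma bencK : pcancel benc bdec.
Proof. by elim=> //= l -> r ->. Qed.

HB.instance Definition _ := Countable.copy btree (pcan_type bencK).

Definition aB (n : nat) (S : ptree) : nat :=
  \sum_(T \in [set T : btree | bsize T = n]) num_emb S (btoP T).
Definition gB (n : nat) (S : ptree) : nat :=
  \sum_(T \in [set T : btree | bsize T = n]) num_good_emb S (btoP T).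

Definition ratio_seq (R : realType) (S : ptree) (k : nat) : R :=
  Num.sqrt ((2 * k + 1)%N%:R) * ((gB (2 * k + 1) S)%:R / (aB (2 * k + 1) S)%:R).

(* Main.v *)
(* A set of vertices of a binary tree [T] induces a plane forest, which is
   computed by recursion on [T]; it embeds [S] iff this forest is [S] alone.
   Hence the embedding counts have generating functions, in the number of
   internal nodes, that satisfy algebraic equations.  With
   [D = sqrt (1 - 4 X) = 1 - 2 X B], where [B] counts the trees, they give
     [X A_S = C (1 - D)^u D^-(w + 1)]  and  [X G_S = C (1 - D)^u D^-w],
   where [w + 1] is the number of edges plus the number of leaves of [S].
   Writing [c_b] for the coefficients of [D^-b], the limit is [sqrt 2] times that
   of [sqrt k * c_w k / c_(w+1) k].  The product formula for [c_b k] shows that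
   this limit exists and, being log-concave in [b], that it is nondecreasing in
   [w]; finally [w] is monotone for the embedding of trees. *)
Require Import Defs.
From HB Require Import structures.
From mathcomp Require Import all_boot all_order all_algebra.
From mathcomp Require Import finmap ring lra zify.
From mathcomp Require Import all_classical all_reals all_analysis.
Set Implicit Arguments. Unset Strict Implicit. Unset Printing Implicit Defensive.
Import Order.TTheory GRing.Theory Num.Theory numFieldNormedType.Exports.
Local Open Scope ring_scope.

(** * Formal power series over a commutative ring *)

Record fps (R : Type) := Fps { fcoef : nat -> R }.

HB.instance Definition _ (R : Type) := gen_eqMixin (fps R).
HB.instance Definition _ (R : Type) := gen_choiceMixin (fps R).

Lemma fpsP (R : Type) (f g : fps R) : fcoef f =1 fcoef g -> f = g.
Proof. by case: f g => [f] [g] /= /funext ->. Qed.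

Section FpsRing.
Variable R : comNzRingType.
Implicit Types f g h : fps R.

Definition fps_add f g := Fps (fun n => fcoef f n + fcoef g n).
Definition fps_opp f := Fps (fun n => - fcoef f n).
Definition fps_zero : fps R := Fps (fun=> 0).

Fact fps_addA : associative fps_add.
Proof. by move=> f g h; apply: fpsP => n /=; rewrite addrA. Qed.
Fact fps_addC : commutative fps_add.
Proof. by move=> f g; apply: fpsP => n /=; rewrite addrC. Qed.
Fact fps_add0 : left_id fps_zero fps_add.
Proof. by move=> f; apply: fpsP => n /=; rewrite add0r. Qed.
Fact fps_addN : left_inverse fps_zero fps_opp fps_add.
Proof. by move=> f; apply: fpsP => n /=; rewrite addNr. Qed.

HB.instance Definition _ :=
  GRing.isZmodule.Build (fps R) fps_addA fps_addC fps_add0 fps_addN.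

Definition fpsC (a : R) : fps R := Fps (fun n => if n is 0 then a else 0).
Definition fps_mul f g :=
  Fps (fun n => \sum_(i < n.+1) fcoef f i * fcoef g (n - i)).

(** Polynomial truncations: a coefficient of a product depends on finitely many coefficients of the
    factors, so ring laws and the product rule carry over from [{poly R}]. *)
Definition fps_trunc n f : {poly R} := \poly_(i < n) fcoef f i.

Lemma coef_trunc_mul n m f g : (m < n)%N ->
  (fps_trunc n f * fps_trunc n g)`_m = fcoef (fps_mul f g) m.
Proof.
move=> mn; rewrite coefM /=; apply: eq_bigr => i _; rewrite !coef_poly.
by rewrite (leq_ltn_trans (leq_ord i) mn) (leq_ltn_trans (leq_subr i m) mn).
Qed.

Fact fps_mulA : associative fps_mul.
Proof.
move=> f g h; apply: fpsP => n.
transitivity ((fps_trunc n.+1 f * (fps_trunc n.+1 g * fps_trunc n.+1 h))`_n).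
  rewrite coefM [LHS]/=; apply: eq_bigr => i _.
  by rewrite coef_trunc_mul ?ltnS ?leq_subr// coef_poly ltn_ord.
rewrite mulrA coefM [RHS]/=; apply: eq_bigr => i _.
by rewrite coef_trunc_mul ?ltn_ord// coef_poly ltnS leq_subr.
Qed.

Fact fps_mulC : commutative fps_mul.
Proof.
move=> f g; apply: fpsP => n.
by rewrite -!(coef_trunc_mul _ _ (ltnSn n)) mulrC.
Qed.

Fact fps_mul1 : left_id (fpsC 1) fps_mul.
Proof.
move=> f; apply: fpsP => n /=; rewrite big_ord_recl /= mul1r subn0.
by rewrite big1 ?addr0// => i _; rewrite mul0r.
Qed.

Fact fps_mulDl : left_distributive fps_mul fps_add.
Proof.
move=> f g h; apply: fpsP => n /=; rewrite -big_split /=.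
by apply: eq_bigr => i _; rewrite mulrDl.
Qed.

Fact fps_oner_neq0 : fpsC 1 != 0.
Proof. by apply/eqP => /(congr1 (fun f => fcoef f 0)) /eqP; rewrite oner_eq0. Qed.

HB.instance Definition _ := GRing.Zmodule_isComNzRing.Build (fps R)
  fps_mulA fps_mulC fps_mul1 fps_mulDl fps_oner_neq0.

Lemma fcoefD f g n : fcoef (f + g) n = fcoef f n + fcoef g n.
Proof. by []. Qed.
Lemma fcoefB f g n : fcoef (f - g) n = fcoef f n - fcoef g n.
Proof. by []. Qed.
Lemma fcoef0 n : fcoef (0 : fps R) n = 0.
Proof. by []. Qed.
Lemma fcoef1 n : fcoef (1 : fps R) n = (n == 0)%:R.
Proof. by case: n. Qed.
Lemma fcoefM f g n :
  fcoef (f * g) n = \sum_(i < n.+1) fcoef f i * fcoef g (n - i).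
Proof. by []. Qed.
Lemma fcoefM0 f g : fcoef (f * g) 0 = fcoef f 0 * fcoef g 0.
Proof. by rewrite fcoefM big_ord_recl big_ord0 addr0. Qed.
Lemma fcoefMn f m n : fcoef (f *+ m) n = fcoef f n *+ m.
Proof.
elim: m => [|m IH]; first by rewrite !mulr0n.
by rewrite !mulrS fcoefD IH.
Qed.
Lemma fcoef_sum I (r : seq I) (P : pred I) (F : I -> fps R) n :
  fcoef (\sum_(i <- r | P i) F i) n = \sum_(i <- r | P i) fcoef (F i) n.
Proof. by apply: (big_morph (fun f => fcoef f n)). Qed.

Lemma fcoefCM a f n : fcoef (fpsC a * f) n = a * fcoef f n.
Proof.
rewrite fcoefM big_ord_recl /= subn0 big1 ?addr0// => i _.
by rewrite mul0r.
Qed.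

Lemma fpsCM a b : fpsC (a * b) = fpsC a * fpsC b.
Proof. by apply: fpsP => n; rewrite fcoefCM; case: n => //= n; rewrite mulr0. Qed.
Lemma fpsCD a b : fpsC (a + b) = fpsC a + fpsC b.
Proof. by apply: fpsP => -[|n] //=; rewrite addr0. Qed.
Lemma fpsC1 : fpsC 1 = 1. Proof. by []. Qed.
Lemma fpsC0 : fpsC 0 = 0. Proof. by apply: fpsP => -[]. Qed.

Definition fpsX : fps R := Fps (fun n => (n == 1)%:R).

Lemma fcoefXM0 f : fcoef (fpsX * f) 0 = 0.
Proof. by rewrite fcoefM0 mul0r. Qed.
Lemma fcoefXMS f n : fcoef (fpsX * f) n.+1 = fcoef f n.
Proof.
rewrite fcoefM big_ord_recl /= mul0r add0r big_ord_recl /= mul1r subn1 /=.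
by rewrite big1 ?addr0// => i _; rewrite mul0r.
Qed.

Definition fps_deriv f : fps R := Fps (fun n => fcoef f n.+1 *+ n.+1).

Lemma fcoef_deriv f n : fcoef (fps_deriv f) n = fcoef f n.+1 *+ n.+1.
Proof. by []. Qed.

Lemma fps_derivM f g :
  fps_deriv (f * g) = fps_deriv f * g + f * fps_deriv g.
Proof.
apply: fpsP => n; rewrite fcoefD.
(* Differentiation lowers degrees by one, so coefficient [n] of the derivative requires truncation
   below degree [n.+2]. *)
set N := n.+2.
have H h : (fps_trunc N h)^`() = fps_trunc n.+1 (fps_deriv h).
  apply/polyP => i; rewrite coef_deriv !coef_poly /N ltnS.
  by case: ifP => //; rewrite mul0rn.
have trE h k i : (i < n.+1)%N -> (fps_trunc n.+1 h * fps_trunc N k)`_i =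
    fcoef (h * k) i.
  move=> ilt; rewrite coefM fcoefM; apply: eq_bigr => j _; rewrite !coef_poly.
  by rewrite (leq_ltn_trans (leq_ord j) ilt) (leq_ltn_trans (leq_subr j i)) // ltnW.
rewrite -trE// [f * fps_deriv g]mulrC -trE// -!H [_ * fps_trunc N f]mulrC.
by rewrite -coefD -derivM coef_deriv /= (coef_trunc_mul _ _ (ltnSn n.+1)).
Qed.

End FpsRing.

(** Once the lower coefficients of [g] vanish, coefficient [n] of [f * g] reduces to the constant
    term of [f] times coefficient [n] of [g]. *)
Lemma fps_mulf_eq0 (R : idomainType) (f g : fps R) :
  fcoef f 0 != 0 -> f * g = 0 -> g = 0.
Proof.
move=> f0 fg; apply: fpsP; elim/ltn_ind => n IH; rewrite fcoef0.
have /eqP := congr1 (fun h => fcoef h n) fg.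
rewrite fcoefM fcoef0 big_ord_recl /= subn0 big1 ?addr0 => [|i _].
  by rewrite mulf_eq0 (negPf f0) => /eqP.
by rewrite IH ?mulr0// /bump /= add1n subnS; case: n {IH} i => [[]//|n] i; lia.
Qed.

(** * The powers of [1 - 4 X] with real exponents *)

Section PowerSeries.
Variable R : numFieldType.
Implicit Types a b : R.

(* The expansion of [(1 - 4 X) ^ (- b / 2)]. *)
Definition sqpow b : fps R :=
  Fps (fun k => \prod_(i < k) ((2 * b + 4 * i%:R) / i.+1%:R)).

Lemma sqpow_coef0 b : fcoef (sqpow b) 0 = 1.
Proof. by rewrite /= big_ord0. Qed.

Lemma sqpow_coefS b k :
  fcoef (sqpow b) k.+1 = fcoef (sqpow b) k * ((2 * b + 4 * k%:R) / k.+1%:R).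
Proof. by rewrite /= big_ord_recr. Qed.

(* A solution of [(1 - 4 X) f' = 2 b f] is determined by its constant term. *)
Lemma sqpow_ode b f :
  (1 - fpsX R *+ 4) * fps_deriv f = fpsC (2 * b) * f ->
  fcoef f 0 = 1 -> f = sqpow b.
Proof.
move=> ode f0; apply: fpsP; elim=> [|k IH]; first by rewrite f0 sqpow_coef0.
have := congr1 (fun h => fcoef h k) ode.
rewrite mulrBl mul1r fcoefB fcoefCM [fpsX R *+ 4 * _]mulrnAl fcoefMn.
have -> : fcoef (fpsX R * fps_deriv f) k = fcoef f k *+ k.
  by case: k {IH} => [|k]; rewrite ?fcoefXM0 ?mulr0n// fcoefXMS.
rewrite fcoef_deriv sqpow_coefS -IH => e.
have k0 : k.+1%:R != 0 :> R by rewrite pnatr_eq0.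
apply: (mulIf k0); rewrite mulrA divfK// [LHS]mulr_natr.
have -> : fcoef f k.+1 *+ k.+1 = 2 * b * fcoef f k + fcoef f k *+ k *+ 4.
  by rewrite -e subrK.
by rewrite -(mulr_natr _ 4) -mulr_natr; ring.
Qed.

Lemma sqpow_deriv b :
  (1 - fpsX R *+ 4) * fps_deriv (sqpow b) = fpsC (2 * b) * sqpow b.
Proof.
apply: fpsP => k; rewrite mulrBl mul1r fcoefB fcoefCM [fpsX R *+ 4 * _]mulrnAl fcoefMn.
have -> : fcoef (fpsX R * fps_deriv (sqpow b)) k = fcoef (sqpow b) k *+ k.
  by case: k => [|k]; rewrite ?fcoefXM0 ?mulr0n// fcoefXMS.
have k0 : k.+1%:R != 0 :> R by rewrite pnatr_eq0.
rewrite fcoef_deriv sqpow_coefS.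
rewrite mulrA -[X in X - _]mulr_natr divfK//; move: (fcoef _ _) => c.
by rewrite -(mulr_natr _ 4) -mulr_natr; ring.
Qed.

(** By the product rule the left side solves the differential equation that characterizes the right
    side. *)
Lemma sqpowD a b : sqpow a * sqpow b = sqpow (a + b).
Proof.
apply: sqpow_ode; last by rewrite fcoefM0 !sqpow_coef0 mulr1.
have := sqpow_deriv a; have := sqpow_deriv b; rewrite fps_derivM mulrDr.
move: (sqpow a) (sqpow b) (fps_deriv (sqpow a)) (fps_deriv (sqpow b)) => a0 b0 a' b'.
by rewrite mulrDr fpsCD => eb ea; rewrite [_ * (a' * b0)]mulrA ea [_ * (a0 * b')]mulrCA eb; ring.
Qed.

Lemma sqpow0 : sqpow 0 = 1.
Proof.
symmetry; apply: sqpow_ode; last by [].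
rewrite mulr0 fpsC0 mul0r; have -> : fps_deriv (1 : fps R) = 0.
  by apply: fpsP => n /=; rewrite mul0rn.
by rewrite mulr0.
Qed.

Lemma sqpow1X n : sqpow 1 ^+ n = sqpow n%:R.
Proof.
elim: n => [|n IH]; first by rewrite mulr0n sqpow0.
by rewrite exprS IH sqpowD -natr1 addrC.
Qed.

Lemma sqpow_N2 : sqpow (- 2) = 1 - fpsX R *+ 4.
Proof.
symmetry; apply: sqpow_ode; last by rewrite fcoefB fcoefMn /= mul0rn subr0.
rewrite mulrC; congr (_ * _); apply: fpsP => n.
rewrite fcoef_deriv fcoefB fcoefMn fcoef1 sub0r /=.
by case: n => [|n] /=; [ring | rewrite mul0rn oppr0 mul0rn].
Qed.

(** Coefficient form of the fact that the derivative of [(1 - 4 X) ^ (- b / 2)] is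
    [2 b (1 - 4 X) ^ (- (b + 2) / 2)]. *)
Lemma sqpow_step2 b k :
  b * fcoef (sqpow (b + 2)) k = (b + 2 * k%:R) * fcoef (sqpow b) k.
Proof.
elim: k => [|k IH]; first by rewrite !sqpow_coef0; ring.
rewrite !sqpow_coefS mulrA IH.
have k0 : k.+1%:R != 0 :> R by rewrite pnatr_eq0.
by rewrite -natr1 in k0 *; field.
Qed.

End PowerSeries.

(** * Asymptotics of the coefficients *)

Section SqpowAsymptotics.
Local Open Scope classical_set_scope.
Variable R : realType.
Implicit Types b : R.

Local Notation c b k := (fcoef (sqpow (b : R)) k).

Lemma sqpow_coef_gt0 b k : 0 < b -> 0 < c b k.
Proof.
move=> b0; elim: k => [|k IH]; first by rewrite sqpow_coef0.
rewrite sqpow_coefS mulr_gt0// divr_gt0 ?ltr0n//.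
by have : 0 <= k%:R :> R by []; lra.
Qed.

Lemma sqpow_coef_ge0 b k : 0 <= b -> 0 <= c b k.
Proof.
move=> b0; elim: k => [|k IH]; first by rewrite sqpow_coef0.
rewrite sqpow_coefS mulr_ge0// divr_ge0 ?ler0n//.
by have : 0 <= k%:R :> R by []; lra.
Qed.

(* Each factor of [c b k] is affine in [b], hence log-concave. *)
Lemma sqpow_coef_logconcave b k : 1 <= b -> c (b - 1) k * c (b + 1) k <= c b k ^+ 2.
Proof.
move=> b1; elim: k => [|k IH]; first by rewrite !sqpow_coef0 mulr1 expr1n.
rewrite !sqpow_coefS mulrACA exprMn ler_pM//.
- by rewrite mulr_ge0// sqpow_coef_ge0//; lra.
- rewrite mulr_ge0// divr_ge0//; have : 0 <= k%:R :> R by [].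
    by lra.
  by lra.
- rewrite mulrACA -invfM -expr2 exprMn -exprVn ler_wpM2r ?exprn_ge0 ?invr_ge0//.
  nra.
Qed.

Lemma sqpow_coef3 k : c (1 + 2) k = (1 + 2 * k%:R) * c 1 k.
Proof. by rewrite -sqpow_step2 mul1r. Qed.

(* [k p_k^2] is nondecreasing while [(2 k + 1) p_k^2] is nonincreasing. *)
Lemma wallis_cvg (p : nat -> R) : p 0 = 1 ->
  (forall k, p k.+1 = p k * ((2 * k%:R + 1) / (2 * k%:R + 2))) ->
  exists2 w : R, 0 < w & Num.sqrt k%:R * p k @[k --> \oo] --> w.
Proof.
move=> p00 pS.
have p0 k : 0 < p k.
  elim: k => [|k IH]; first by rewrite p00.
  have k0 : 0 <= k%:R :> R by [].
  by rewrite pS mulr_gt0// divr_gt0//; lra.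
pose v k := Num.sqrt k%:R * p k.
have v0 k : 0 <= v k by rewrite mulr_ge0 ?sqrtr_ge0 ?ltW.
have v2 k : v k ^+ 2 = k%:R * p k ^+ 2 by rewrite exprMn sqr_sqrtr.
have incr : nondecreasing_seq v.
  apply/nondecreasing_seqP => k; rewrite -(@ler_pXn2r _ 2)// ?nnegrE//.
  rewrite !v2 pS [X in _ <= _ * X]exprMn [leRHS]mulrCA [leLHS]mulrC ler_wpM2l ?sqr_ge0//.
  have k0 : 0 <= k%:R :> R by [].
  have d0 : 0 < 2 * k%:R + 2 :> R by lra.
  rewrite exprMn exprVn mulrA ler_pdivlMr ?exprn_gt0//.
  by rewrite -natr1; nra.
have bound k : (2 * k%:R + 1) * p k ^+ 2 <= 1.
  elim: k => [|k IH].
    by rewrite p00 expr1n mulr0 add0r mulr1.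
  apply: le_trans IH; rewrite pS [X in _ * X]exprMn [leLHS]mulrCA [leRHS]mulrC.
  rewrite ler_wpM2l ?sqr_ge0//.
  have k0 : 0 <= k%:R :> R by [].
  have d0 : 0 < 2 * k%:R + 2 :> R by lra.
  rewrite exprMn exprVn mulrA ler_pdivrMr ?exprn_gt0//.
  by rewrite -natr1; nra.
have vle1 k : v k <= 1.
  rewrite -(@ler_pXn2r _ 2)// ?nnegrE// v2 expr1n.
  apply: le_trans (bound k); rewrite ler_wpM2r ?sqr_ge0//.
  by have : 0 <= k%:R :> R by []; lra.
have vcvg : cvgn v.
  by apply: nondecreasing_is_cvgn => //; exists 1 => _ [k _ <-].
exists (limn v) => //.
(* The limit of the nondecreasing [v] is at least [v 1], the first positive term, since [v 0] is
   zero. *)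
apply: lt_le_trans (nondecreasing_cvgn_le incr vcvg 1).
by rewrite mulr_gt0// sqrtr_gt0.
Qed.


(** Here [c 1 k] is the central binomial coefficient and [c 2 k] is [4 ^ k], so this is Wallis's
    limit. *)
Lemma central_cvg : exists2 w : R, 0 < w &
  Num.sqrt k%:R * (c 1 k / c 2 k) @[k --> \oo] --> w.
Proof.
apply: wallis_cvg => [|k]; first by rewrite !sqpow_coef0 divr1.
rewrite !sqpow_coefS; have k0 : 0 <= k%:R :> R by [].
have := sqpow_coef_gt0 k (ltr0n R 2) => c0.
by rewrite -natr1; field; apply/and4P; split; apply/eqP; lra.
Qed.

(** Serves to extract the limit of [f] from an exact formula for its product with a sequence of
    known nonzero limit. *)
Lemma cvg_mulKr (f g : R^nat) (l m : R) : m != 0 ->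
  f k * g k @[k --> \oo] --> l -> g k @[k --> \oo] --> m ->
  f k @[k --> \oo] --> l / m.
Proof.
move=> m0 fg gm.
have : (f k * g k) * (g k)^-1 @[k --> \oo] --> l / m.
  by apply: cvgM => //; exact: cvgV.
apply: cvg_trans; apply: near_eq_cvg; near=> k.
rewrite mulfK//; near: k; exact: (cvgr_neq0 _ gm).
Unshelve. all: by end_near. Qed.

Lemma cvg_divnS (a : R) : a / k.+1%:R @[k --> \oo] --> (0 : R).
Proof. by rewrite -[X in _ --> X](mulr0 a); apply: cvgMl_tmp; exact: cvg_harmonic. Qed.

Lemma cvg_affine_div (a b : R) : b + a / k.+1%:R @[k --> \oo] --> b.
Proof.
rewrite -[X in _ --> X]addr0.
by apply: cvgD; [exact: cvg_cst|exact: cvg_divnS].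
Qed.

(** [sqpow_step2] raises both exponents of the quotient by two at the cost of a convergent factor,
    so induction goes from [b] to [b + 2], with [b] equal to 0, 1 and 2 treated directly. *)
Lemma sqpow_ratio_cvg (b : nat) : exists l : R,
  Num.sqrt k.+1%:R * (c b%:R k.+1 / c b.+1%:R k.+1) @[k --> \oo] --> l.
Proof.
have k0 k : k.+1%:R != 0 :> R by rewrite pnatr_eq0.
have c0 j k : c j.+1%:R k != 0 by rewrite lt0r_neq0 ?sqpow_coef_gt0.
have [w w0 wP] := central_cvg.
have wS : Num.sqrt k.+1%:R * (c 1 k.+1 / c 2 k.+1) @[k --> \oo] --> w.
  by move: wP; rewrite -cvg_shiftS.
elim/ltn_ind: b => -[|[|[|b]]] IH.
(* [sqpow 0] is the constant series 1, whose coefficients of positive index vanish. *)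
- exists 0; rewrite [X in X @ _](_ : _ = fun=> 0); first exact: cvg_cst.
  by apply/funext => k; rewrite sqpow0 /= mul0r mulr0.
- by exists w; exact: wS.
(* As [c 3 = (1 + 2 k) c 1], the sequence times [2 + 1 / k] and times the Wallis sequence is exactly
   1, where [k] is the shifted index. *)
- exists (1 / w / 2); apply: (cvg_mulKr _ _ (@cvg_affine_div 1 2)) => //.
  apply: (cvg_mulKr _ _ wS); first exact: lt0r_neq0.
  rewrite [X in X @ _](_ : _ = fun=> 1); first exact: cvg_cst.
  apply/funext => k; have e : c 3%:R k.+1 = (1 + 2 * k.+1%:R) * c 1 k.+1.
    by rewrite -sqpow_coef3; congr (fcoef (sqpow _) _); ring.
  rewrite e; set s := Num.sqrt _; have := c0 0 k.+1; have := c0 1 k.+1.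
  have : 1 + 2 * k.+1%:R != 0 :> R by rewrite lt0r_neq0// addr_gt0// mulr_gt0.
  have : k.+1%:R = s ^+ 2 by rewrite sqr_sqrtr.
  have : s != 0 by rewrite sqrtr_eq0 -ltNge.
  move: (c 1 _) (c 2 _) => x y s0 -> d0 y0 x0.
  by field; apply/and4P.
- have [l lP] := IH b.+1 (ltnW (ltnSn _)).
  exists (l * (b.+2%:R / b.+1%:R)).
  have H : (2 + b.+1%:R / k.+1%:R) / (2 + b.+2%:R / k.+1%:R) @[k --> \oo] --> (2 / 2 : R).
    by apply: cvgM; [|apply: cvgV => //]; exact: cvg_affine_div.
  rewrite divff// in H.
  rewrite -[X in _ --> X]mulr1.
  rewrite [X in X @ _](_ : _ = fun k =>
    (Num.sqrt k.+1%:R * (c b.+1%:R k.+1 / c b.+2%:R k.+1)) * (b.+2%:R / b.+1%:R)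
    * ((2 + b.+1%:R / k.+1%:R) / (2 + b.+2%:R / k.+1%:R))).
    by apply: cvgM => //; exact: cvgMr_tmp.
  apply/funext => k.
  have e1 := sqpow_step2 (b.+1%:R : R) k.+1.
  have e2 := sqpow_step2 (b.+2%:R : R) k.+1.
  rewrite -[_.+1%:R + 2]natrD addn2 in e1; rewrite -[_.+2%:R + 2]natrD addn2 in e2.
  have -> : c b.+3%:R k.+1 = (b.+1%:R + 2 * k.+1%:R) * c b.+1%:R k.+1 / b.+1%:R.
    by rewrite -e1 mulrC mulKf// pnatr_eq0.
  have -> : c b.+4%:R k.+1 = (b.+2%:R + 2 * k.+1%:R) * c b.+2%:R k.+1 / b.+2%:R.
    by rewrite -e2 mulrC mulKf// pnatr_eq0.
  have := c0 b.+1 k.+1; move: (c _ _) (c _ _) (Num.sqrt _) => x y s x0.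
  have k1 : 0 <= k%:R :> R by []; have b1 : 0 <= b%:R :> R by [].
  by field; apply/and5P; split=> //; apply/eqP; lra.
Qed.

(** Log-concavity in the exponent compares consecutive quotients; unit steps are chained. *)
Lemma sqpow_ratio_le (b1 b2 : nat) k : (b1 <= b2)%N ->
  c b1%:R k / c b1.+1%:R k <= c b2%:R k / c b2.+1%:R k.
Proof.
elim: b2 => [|b2 IH]; first by rewrite leqn0 => /eqP ->.
rewrite leq_eqVlt => /predU1P[->//|/IH]; move=> /le_trans; apply.
rewrite ler_pdivrMr ?sqpow_coef_gt0// mulrAC ler_pdivlMr ?sqpow_coef_gt0//.
have := @sqpow_coef_logconcave b2.+1%:R k; rewrite natr1 -[in X in X - 1]natr1 addrK.
by apply; rewrite ler1n.
Qed.

Lemma sqpow_ratio_lim_le (b1 b2 : nat) (l1 l2 : R) : (b1 <= b2)%N ->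
  Num.sqrt k.+1%:R * (c b1%:R k.+1 / c b1.+1%:R k.+1) @[k --> \oo] --> l1 ->
  Num.sqrt k.+1%:R * (c b2%:R k.+1 / c b2.+1%:R k.+1) @[k --> \oo] --> l2 ->
  l1 <= l2.
Proof.
move=> b12 /ler_cvg_to h /h; apply; near=> k.
by rewrite ler_wpM2l// sqpow_ratio_le.
Unshelve. all: by end_near. Qed.

Lemma cvg_invsqrtS : (Num.sqrt k.+1%:R)^-1 @[k --> \oo] --> (0 : R).
Proof.
rewrite -[X in _ --> X]sqrtr0.
rewrite [X in X @ _](_ : _ = fun k => Num.sqrt (k.+1%:R^-1)).
  by apply: continuous_cvg; [exact: sqrt_continuous|exact: cvg_harmonic].
by apply/funext => k; rewrite sqrtrV.
Qed.

Section FixedExponent.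
Variables (b : nat) (l : R).
Hypothesis lP :
  Num.sqrt k.+1%:R * (c b%:R k.+1 / c b.+1%:R k.+1) @[k --> \oo] --> l.

Let c0 k : c b.+1%:R k != 0.
Proof. by rewrite lt0r_neq0 ?sqpow_coef_gt0. Qed.

Let s0 k : Num.sqrt k.+1%:R != 0 :> R.
Proof. by rewrite sqrtr_eq0 -ltNge. Qed.

(* [c a] is [O(1/k)] times [c (a + 2)] by [sqpow_step2], which leaves only
   [j = 0] and [j = 1] to treat by hand. *)
Lemma sqpow_lower_cvg j :
  Num.sqrt k.+1%:R * (c (b%:R - j%:R) k.+1 / c b.+1%:R k.+1) @[k --> \oo]
    --> (if j == 0 then l else 0).
Proof.
(* By [sqpow_step2], the sequence in the conclusion times [2 + a / k.+1] is [a] times the sequence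
   in the hypothesis. *)
have step a m : c (a + 2) k.+1 / c b.+1%:R k.+1 / Num.sqrt k.+1%:R @[k --> \oo] --> (m : R) ->
  a * m = 0 ->
  Num.sqrt k.+1%:R * (c a k.+1 / c b.+1%:R k.+1) @[k --> \oo] --> (0 : R).
  move=> H am; rewrite -(mul0r (2^-1)) -am.
  apply: (cvg_mulKr _ _ (@cvg_affine_div a 2)) => //.
  rewrite [X in X @ _](_ : _ = fun k => a * (c (a + 2) k.+1 / c b.+1%:R k.+1 / Num.sqrt k.+1%:R)).
    exact: cvgMl_tmp.
  apply/funext => k; have e := sqpow_step2 a k.+1.
  rewrite !mulrA e; have := s0 k; have := c0 k.+1.
  have : k.+1%:R = Num.sqrt k.+1%:R ^+ 2 :> R by rewrite sqr_sqrtr.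
  move: (Num.sqrt _) (c a _) (c _ _) => s x y -> y0 s'0.
  by field; apply/andP.
elim/ltn_ind: j => -[|[|j]] IH.
- by rewrite subr0.
(* For [j = 1], raising the exponent by two gives [b.+1]: the quotient of coefficients is 1 and only
   the inverse square root is left. *)
- apply: (@step _ 0); last by rewrite mulr0.
  rewrite [X in X @ _](_ : _ = fun k => (Num.sqrt k.+1%:R)^-1).
    exact: cvg_invsqrtS.
  apply/funext => k; have -> : b%:R - 1%:R + 2 = b.+1%:R :> R by rewrite -natr1; ring.
  by rewrite divff// mul1r.
(* Raising the exponent by two leads back to [j], whose sequence converges; the remaining factor is
   [1 / k.+1]. *)
- apply: (@step _ 0); last by rewrite mulr0.
  have -> : b%:R - j.+2%:R + 2 = b%:R - j%:R :> R by rewrite -addn2 natrD; ring.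
  rewrite [X in X @ _](_ : _ = fun k => (Num.sqrt k.+1%:R)^-1 ^+ 2 *
    (Num.sqrt k.+1%:R * (c (b%:R - j%:R) k.+1 / c b.+1%:R k.+1))).
    rewrite -(mul0r (if j == 0 then l else 0)); apply: cvgM; last exact: IH.
    by rewrite -[X in _ --> X](mul0r 0); apply: cvgM; exact: cvg_invsqrtS.
  apply/funext => k; have := s0 k; have := c0 k.+1.
  by move: (Num.sqrt _) (c _ _) (c _ _) => s x y y0 s'0; field; apply/andP.
Qed.

Local Notation E u a := ((1 - sqpow (-1)) ^+ u * sqpow (a : R)).

(** Multiplication by [D] lowers the exponent by one, so a factor [1 - D] only adds terms of lower
    order; it changes none of the limits below. *)
Lemma comb_recl u (a : R) : E u.+1 a = E u a - E u (a - 1).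
Proof. by rewrite exprSr -mulrA mulrBl mul1r sqpowD mulrBr [-1 + a]addrC. Qed.

Lemma comb_lower_cvg u j :
  Num.sqrt k.+1%:R * (fcoef (E u (b%:R - j%:R)) k.+1 / c b.+1%:R k.+1) @[k --> \oo]
    --> (if j == 0 then l else 0).
Proof.
elim: u j => [|u IH] j; first by rewrite expr0 mul1r; exact: sqpow_lower_cvg.
rewrite comb_recl -[X in _ --> X]subr0.
rewrite [X in X @ _](_ : _ = fun k =>
   Num.sqrt k.+1%:R * (fcoef (E u (b%:R - j%:R)) k.+1 / c b.+1%:R k.+1)
   - Num.sqrt k.+1%:R * (fcoef (E u (b%:R - j.+1%:R)) k.+1 / c b.+1%:R k.+1)).
  by apply: cvgB; [exact: IH|exact: (IH j.+1)].
apply/funext => k; rewrite fcoefB -[j.+1%:R]natr1 opprD addrA; ring.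
Qed.

Lemma comb_cvg u : fcoef (E u b.+1%:R) k.+1 / c b.+1%:R k.+1 @[k --> \oo] --> (1 : R).
Proof.
elim: u => [|u IH].
  rewrite [X in X @ _](_ : _ = fun=> 1); first exact: cvg_cst.
  by apply/funext => k; rewrite expr0 mul1r divff.
rewrite comb_recl -[X in _ --> X]subr0.
rewrite [X in X @ _](_ : _ = fun k => fcoef (E u b.+1%:R) k.+1 / c b.+1%:R k.+1
  - (Num.sqrt k.+1%:R)^-1 *
    (Num.sqrt k.+1%:R * (fcoef (E u (b%:R - 0%:R)) k.+1 / c b.+1%:R k.+1))).
  apply: cvgB => //; rewrite -(mul0r l); apply: cvgM; first exact: cvg_invsqrtS.
  exact: (@comb_lower_cvg u 0).
by apply/funext => k; rewrite fcoefB subr0 mulKf// -[b.+1%:R]natr1 addrK mulrBl.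
Qed.

Lemma comb_ratio_cvg u :
  Num.sqrt (2 * k + 1)%N%:R * (fcoef (E u b%:R) k.+1 / fcoef (E u b.+1%:R) k.+1)
    @[k --> \oo] --> Num.sqrt 2 * l.
Proof.
rewrite -[X in _ --> X]divr1.
(* The factor [sqrt 2] comes from [2 k + 1 = (k + 1) (2 - 1 / (k + 1))]; the numerator and the
   denominator are both normalized by [c b.+1]. *)
rewrite [X in X @ _](_ : _ = fun k => Num.sqrt (2 + -1 / k.+1%:R) *
   (Num.sqrt k.+1%:R * (fcoef (E u (b%:R - 0%:R)) k.+1 / c b.+1%:R k.+1)) /
   (fcoef (E u b.+1%:R) k.+1 / c b.+1%:R k.+1)).
  apply: cvgM; last by apply: cvgV; [exact: oner_neq0|exact: comb_cvg].
  apply: cvgM; last exact: (@comb_lower_cvg u 0).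
  apply: continuous_cvg; first exact: sqrt_continuous.
  exact: cvg_affine_div.
apply/funext => k; rewrite subr0 invf_div mulrA -sqrtrM; last first.
  by rewrite mulN1r subr_ge0 (le_trans (y := 1))// ?invf_le1 ?ler1n.
rewrite -!mulrA [(c _ _)^-1 * _]mulrA mulVf// mul1r; congr (Num.sqrt _ * _).
have := pnatr_eq0 R k.+1; rewrite natrD natrM -natr1 => /negbT k0; field.
exact: k0.
Qed.

End FixedExponent.

End SqpowAsymptotics.

(** * Plane forests induced by sets of vertices *)

Lemma prefix_rcons_nil (p : seq nat) i : prefix (rcons p i) [::] = false.
Proof. by case: p. Qed.

Lemma leftof_cons a b (x y : seq nat) :
  leftof (a :: x) (b :: y) <-> (a < b)%N \/ a = b /\ leftof x y.
Proof.
split=> [[[|c p] [i [j [ij]]]]|[ab|[-> [p [i [j [ij px py]]]]]]] /=.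
- by rewrite ?prefix_cons ?prefix0s ?andbT => /eqP <- /eqP <-; left.
- rewrite ?prefix_cons => /andP[/eqP <- px] /andP[/eqP <- py].
  by right; split=> //; exists p, i, j.
- by exists [::], a, b; rewrite /= ?prefix_cons !eqxx !prefix0s.
- by exists (b :: p), i, j; rewrite /= ?prefix_cons !eqxx.
Qed.

Lemma nil_verts t : [::] \in verts t.
Proof. by case: t => ts; rewrite inE. Qed.

Lemma vertsE ts : verts (PNode ts) =
  [::] :: [seq i :: v | i <- iota 0 (size ts), v <- verts (nth (PNode [::]) ts i)].
Proof.
rewrite /=; congr (_ :: flatten _).
rewrite -[ts in map verts ts](mkseq_nth (PNode [::])) /mkseq -map_comp.
by elim: (iota _ _) => //= j s ->.
Qed.

Lemma cons_verts i v ts :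
  (i :: v \in verts (PNode ts)) = (i < size ts)%N && (v \in verts (nth (PNode [::]) ts i)).
Proof.
rewrite vertsE inE /=; apply/allpairsPdep/andP => [[j [w [+ wv [-> ->]]]]|[ilt vi]].
  by rewrite mem_iota.
by exists i, v; rewrite mem_iota.
Qed.

(* The vertices of a plane forest, addressed as the non-root vertices of the
   tree obtained by joining its roots to a common parent. *)
Definition fverts (ss : seq ptree) (v : seq nat) : bool :=
  (v != [::]) && (v \in verts (PNode ss)).

Lemma fverts_cons ss i v :
  fverts ss (i :: v) = (i < size ss)%N && (v \in verts (nth (PNode [::]) ss i)).
Proof. by rewrite /fverts cons_verts. Qed.

Lemma fverts1 ss i : fverts ss [:: i] = (i < size ss)%N.
Proof. by rewrite fverts_cons nil_verts andbT. Qed.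

Lemma fverts_root ss i v : fverts ss (i :: v) -> fverts ss [:: i].
Proof. by rewrite fverts1 fverts_cons => /andP[]. Qed.

(** The conditions of [is_embedding] for arbitrary sets of addresses, so that they also apply to
    forests and to the part of a set inside a subtree. *)
Definition plane_iso (V E : seq nat -> bool) (f : seq nat -> seq nat) : Prop :=
  [/\ forall v, V v -> E (f v),
      forall w, E w -> exists2 v, V v & f v = w,
      forall u v, V u -> V v -> tle u v = tle (f u) (f v)
    & forall p i j, V (rcons p i) -> V (rcons p j) -> (i < j)%N ->
        leftof (f (rcons p i)) (f (rcons p j))].

Definition plane_isomorphic V E := exists f, plane_iso V E f.

(* The plane forest induced by the set [E] of vertices of [T]. *)
Fixpoint shape (T : btree) (E : seq nat -> bool) : seq ptree :=
  let s := if T is BNode l r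
    then shape l (fun v => E (0%N :: v)) ++ shape r (fun v => E (1%N :: v))
    else [::] in
  if E [::] then [:: PNode s] else s.

Definition nonroot (E : seq nat -> bool) v := (v != [::]) && E v.

Section ShapeIso.
Implicit Types (E : seq nat -> bool).

Lemma iso_empty E : (forall v, E v = false) -> plane_isomorphic (fverts [::]) E.
Proof. by move=> E0; exists id; split=> [[|a v]|w||[|a p] ? ?] //; rewrite ?E0 ?fverts_cons. Qed.

Lemma iso_add_root s E : E [::] -> plane_isomorphic (fverts s) (nonroot E) ->
  plane_isomorphic (fverts [:: PNode s]) E.
Proof.
move=> E0 [g [gE gS gT gL]].
(* The new root [[:: 0]] goes to [[::]]; below it, the leading 0 is dropped and [g] applied. *)
pose f v := if v is _ :: (_ :: _) as w then g w else [::].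
have fvE i v : fverts [:: PNode s] (i :: v) = (i == 0%N) && ((v == [::]) || fverts s v).
  rewrite fverts_cons ltnS leqn0; case: eqP => //= ->.
  by rewrite /fverts; case: (v =P [::]) => [->|//]; rewrite nil_verts.
have g0 v : fverts s v -> g v != [::] by move=> /gE /andP[].
exists f; split.
- move=> [|i [|j v]] //; rewrite fvE => /andP[_] /= fv.
  by have /gE/andP[] := fv.
- move=> [|a w] Ew; first by exists [:: 0%N]; rewrite ?fvE.
  have [|v fv <-] := gS (a :: w); first by rewrite /nonroot.
  exists (0%N :: v); first by rewrite fvE fv orbT.
  by case: v fv.
- move=> [|i u] [|j v] //; rewrite !fvE => /andP[/eqP-> fu] /andP[/eqP-> fv].
  rewrite /tle prefix_cons eqxx /=.
  case: v u fu fv => [|b v] [|a u] // fu fv.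
    by rewrite !prefix0s.
    by have := g0 _ fv; case: (g _).
  exact: (gT (a :: u) (b :: v)).
- move=> [|a p] i j; first by rewrite !fvE /= => /andP[/eqP-> _] /andP[/eqP->].
  rewrite /= !fvE => /andP[_]; have nn k : (rcons p k == [::]) = false by case: (p).
  rewrite !nn /= => fi /andP[_ fj] ij; have := gL _ _ _ fi fj ij.
  by case: (p).
Qed.

Lemma iso_cat s1 s2 E :
  (forall a v, E (a :: v) -> (a < 2)%N) ->
  plane_isomorphic (fverts s1) (fun v => E (0%N :: v)) ->
  plane_isomorphic (fverts s2) (fun v => E (1%N :: v)) ->
  plane_isomorphic (fverts (s1 ++ s2)) (nonroot E).
Proof.
move=> E2 [f [fE fS fT fL]] [g [gE gS gT gL]].
pose k := size s1.
(* The first [k] trees go to the left subtree, the others to the right one after renumbering from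
   0. *)
pose h v := if v is i :: w then
  if (i < k)%N then 0%N :: f v else 1%N :: g ((i - k)%N :: w) else [::].
have fvE i w : fverts (s1 ++ s2) (i :: w) =
    if (i < k)%N then fverts s1 (i :: w) else fverts s2 ((i - k)%N :: w).
  rewrite !fverts_cons nth_cat size_cat; rewrite /k; case: (ltnP i (size s1)) => // ki.
    by rewrite ltn_addr.
  by rewrite ltn_subLR.
exists h; split.
- by move=> [|i w] //; rewrite fvE /h /nonroot; case: ifP => _ /=; [exact: fE|exact: gE].
- move=> [|[|[|a]] w] /andP[//= _] Ew; last by have := E2 _ _ Ew.
    have [[|i v] // fv <-] := fS _ Ew; exists (i :: v); rewrite ?fvE /h.
      by rewrite ifT//; move: fv; rewrite fverts_cons => /andP[].
    by rewrite ifT//; move: fv; rewrite fverts_cons => /andP[].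
  have [[|i v] fv <-] := gS _ Ew; first by [].
  by exists ((k + i)%N :: v); rewrite ?fvE /h ltnNge leq_addr /= addKn.
- move=> [|i u] [|j v] //; rewrite !fvE /h; case: ifPn => ik; case: ifPn => jk fu fv.
  + by rewrite [RHS]/tle prefix_cons eqxx; exact: fT.
  + rewrite /tle !prefix_cons /=; case: eqP => // ji; move: jk ik.
    by rewrite ji => /negPf ->.
  + rewrite /tle !prefix_cons /=; case: eqP => // ji; move: jk ik.
    by rewrite ji => ->.
  + rewrite [RHS]/tle prefix_cons eqxx /= -/(tle _ _) -gT// /tle !prefix_cons.
    by congr (_ && _); apply/eqP/eqP; lia.
- move=> [|a p] i j; rewrite /= !fvE /h.
    case: ifPn => ik; case: ifPn => jk fi fj ij; apply/leftof_cons; [right|by left|lia|right].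
      by split=> //; exact: (fL [::]).
    by split=> //; apply: (gL [::]) => //; lia.
  case: ifPn => ak fi fj ij; apply/leftof_cons; right; split=> //.
    exact: (fL (a :: p)).
  exact: (gL ((a - k)%N :: p)).
Qed.

Lemma iso_shape T E : (forall v, E v -> v \in verts (btoP T)) ->
  plane_isomorphic (fverts (shape T E)) E.
Proof.
elim: T E => [|l IHl r IHr] E ET.
  have E1 a v : E (a :: v) = false by apply/negP => /ET.
  rewrite /=; case: ifP => E0; last by apply: iso_empty => -[|a v].
  by apply: iso_add_root => //; apply: iso_empty => -[|a v] //; rewrite /nonroot E1.
have E2 a v : E (a :: v) -> (a < 2)%N by move=> /ET; rewrite cons_verts => /andP[].
have {IHl IHr}I := iso_cat E2 (IHl (fun v => E (0%N :: v)) _) (IHr (fun v => E (1%N :: v)) _).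
rewrite /=; case: ifP => E0; first apply: iso_add_root => //.
  by apply: I => v /ET; rewrite cons_verts.
have -> : E = nonroot E by apply/funext => -[|a v] //; rewrite /nonroot E0.
by apply: I => v /ET; rewrite cons_verts.
Qed.

Lemma iso_empty_inv ss E : (forall v, E v = false) ->
  plane_isomorphic (fverts ss) E -> ss = [::].
Proof.
move=> E0 [f [fE _ _ _]]; case: ss fE => // s ss /(_ [:: 0%N]).
by rewrite fverts1 E0 => /(_ isT).
Qed.

(** The root is the maximum of [E], so its preimage is an ancestor of every vertex of the forest,
    which is therefore a single tree. *)
Lemma iso_root_inv ss E : E [::] -> plane_isomorphic (fverts ss) E ->
  exists2 s, ss = [:: PNode s] & plane_isomorphic (fverts s) (nonroot E).
Proof.
move=> E0 [f [fE fS fT fL]].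
have [[|i w] fv fv0] := fS _ E0; first by [].
have top u : fverts ss u -> prefix (i :: w) u.
  by move=> fu; have := fT _ _ fu fv; rewrite fv0 /tle prefix0s.
have w0 : w = [::].
  have := top _ (fverts_root fv); rewrite prefix_cons => /andP[_].
  by rewrite prefixs0 => /eqP.
move: fv fv0 top; rewrite {w}w0 fverts1 => fi fi0 top.
have alli j : (j < size ss)%N -> j = i.
  by rewrite -fverts1 => /top; rewrite prefix_cons => /andP[/eqP].
have i0 : i = 0%N by apply/esym/alli; lia.
have ss1 : size ss = 1%N.
  case: (ltnP 1 (size ss)) => [/alli|]; lia.
move: ss1 fE fS fT fL fi0 => {fi top alli}; rewrite {i}i0.
case: ss => [|[s] [|? ?]] //= _ fE fS fT fL f0.
have fvE v : fverts s v -> fverts [:: PNode s] (0%N :: v).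
  by rewrite fverts_cons => /andP[_ ->].
exists s => //; exists (fun v => f (0%N :: v)); split.
- move=> v fv; rewrite /nonroot fE ?fvE// andbT; apply/negP => /eqP fv0.
  have := fT [:: 0%N] (0%N :: v); rewrite (fvE v)// fverts1 f0 fv0 => /(_ isT isT).
  by case: v fv {fv0}.
- move=> w /andP[wn /fS[[|i v] //]]; rewrite fverts_cons => /andP[].
  rewrite ltnS leqn0 => /eqP-> /= vs fw; exists v => //; rewrite /fverts vs andbT.
  by apply: contra wn => /eqP v0; rewrite -fw v0 f0.
- by move=> u v fu fv; rewrite -fT ?fvE// /tle prefix_cons eqxx.
- by move=> p i j fi fj; apply: (fL (0%N :: p)); exact: fvE.
Qed.

(** Comparable vertices lie in the same subtree, so each tree of the forest stays on one side; by
    the left-to-right order the trees going left form an initial segment. *)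
Lemma iso_cat_inv ss E : E [::] = false ->
  (forall a v, E (a :: v) -> (a < 2)%N) ->
  plane_isomorphic (fverts ss) E ->
  exists s1 s2, [/\ ss = s1 ++ s2,
    plane_isomorphic (fverts s1) (fun v => E (0%N :: v))
  & plane_isomorphic (fverts s2) (fun v => E (1%N :: v))].
Proof.
move=> E0 E2 [f [fE fS fT fL]].
(* [h v] tells which of the two subtrees contains the image of [v]. *)
pose h v := head 0%N (f v).
have fh v : fverts ss v -> f v = h v :: behead (f v).
  by move=> /fE; rewrite /h; case: (f v) => //; rewrite E0.
have h2 v : fverts ss v -> (h v < 2)%N by move=> fv; have := fE _ fv; rewrite fh// => /E2.
have h1 i v : fverts ss (i :: v) -> h (i :: v) = h [:: i].
  move=> fv; have := fT _ _ fv (fverts_root fv).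
  rewrite /tle prefix_cons eqxx prefix0s (fh _ fv) (fh _ (fverts_root fv)) prefix_cons.
  by case: eqP.
have hm i j : (i < j)%N -> (j < size ss)%N -> (h [:: i] <= h [:: j])%N.
  move=> ij js; have is_ := ltn_trans ij js.
  have := fL [::] i j; rewrite /= !fverts1 => /(_ is_ js ij).
  rewrite fh ?fverts1// (fh [:: j]) ?fverts1// => /leftof_cons[/ltnW|[->]] //.
(* Index of the first tree sent to the right; [find] returns the number of trees when there is
   none. *)
pose k := find (fun i => h [:: i] == 1%N) (iota 0 (size ss)).
have kle : (k <= size ss)%N by rewrite -[leqRHS](size_iota 0) find_size.
have hlt i : (i < k)%N -> h [:: i] = 0%N.
  move=> ik; have := before_find 0%N ik; rewrite nth_iota ?(leq_trans ik)//=.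
  by have := h2 [:: i]; rewrite fverts1 add0n => /(_ (leq_trans ik kle)); case: (h _) => [|[]].
have hge i : (k <= i)%N -> (i < size ss)%N -> h [:: i] = 1%N.
  move=> ki is_; have ks := leq_ltn_trans ki is_.
  have hk : h [:: k] = 1%N.
    have : has (fun i => h [:: i] == 1%N) (iota 0 (size ss)).
      by rewrite has_find size_iota.
    by move=> /(nth_find 0%N); rewrite nth_iota// => /eqP.
  move: ki; rewrite leq_eqVlt => /predU1P[<-//|ki].
  have := hm _ _ ki is_; have := h2 [:: i]; rewrite fverts1 hk => /(_ is_).
  by case: (h _) => [|[]].
have fv1 i v : fverts (take k ss) (i :: v) = (i < k)%N && fverts ss (i :: v).
  rewrite !fverts_cons size_takel//; case: ltnP => //= ik.
  by rewrite nth_take// (leq_trans ik).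
have fv2 i v : fverts (drop k ss) (i :: v) = fverts ss ((k + i)%N :: v).
  by rewrite !fverts_cons size_drop nth_drop ltn_subRL.
have f0 i v : (i < k)%N -> fverts ss (i :: v) -> f (i :: v) = 0%N :: behead (f (i :: v)).
  by move=> ik fv; rewrite {1}fh// h1// hlt.
have f1 i v : (k <= i)%N -> fverts ss (i :: v) -> f (i :: v) = 1%N :: behead (f (i :: v)).
  by move=> ik fv; rewrite {1}fh// h1// hge// -fverts1; exact: fverts_root fv.
exists (take k ss), (drop k ss); rewrite cat_take_drop; split=> //.
- exists (fun v => behead (f v)); split.
  + by move=> [|i v] //; rewrite fv1 => /andP[ik fv]; rewrite -f0//; exact: fE.
  + move=> w /fS[[|i v] // fv fw]; exists (i :: v); last by rewrite fw.
    rewrite fv1 fv andbT ltnNge; apply/negP => ki.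
    by have := f1 _ _ ki fv; rewrite fw.
  + move=> [|i u] [|j v] //; rewrite !fv1 => /andP[ik fu] /andP[jk fv].
    by rewrite (fT _ _ fu fv) f0// (f0 j)//= /tle prefix_cons eqxx.
  + move=> p i j fi fj ij.
    have H q : fverts (take k ss) (rcons p q) ->
        fverts ss (rcons p q) /\ f (rcons p q) = 0%N :: behead (f (rcons p q)).
      by case: (p) => [|a p'] /=; rewrite fv1 => /andP[ik fq]; split=> //; exact: f0.
    have [fi' ei] := H _ fi; have [fj' ej] := H _ fj.
    by have := fL _ _ _ fi' fj' ij; rewrite ei ej => /leftof_cons[|[]].
- pose sh v := if v is i :: w then (k + i)%N :: w else [::].
  have H v : fverts (drop k ss) v -> fverts ss (sh v) /\ f (sh v) = 1%N :: behead (f (sh v)).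
    by case: v => [|i v] //; rewrite fv2 => fv; split=> //; apply: f1 => //; exact: leq_addr.
  exists (fun v => behead (f (sh v))); split.
  + by move=> v /H[fv <-]; exact: fE.
  + move=> w /fS[[|i v] // fv fw].
    have ki : (k <= i)%N by rewrite leqNgt; apply/negP => ik; have := f0 _ _ ik fv; rewrite fw.
    by exists ((i - k)%N :: v); rewrite ?fv2 /= subnKC// fw.
  + move=> u v fu fv; have [fu' eu] := H _ fu; have [fv' ev] := H _ fv.
    have -> : tle u v = tle (sh u) (sh v).
      by case: u v fu fv {fu' eu fv' ev} => [|i u] [|j v] // _ _; rewrite /tle !prefix_cons eqn_add2l.
    by rewrite fT// eu ev /tle prefix_cons eqxx.
  + move=> p i j fi fj ij; have [fi' ei] := H _ fi; have [fj' ej] := H _ fj.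
    suff : leftof (f (sh (rcons p i))) (f (sh (rcons p j))).
      by rewrite ei ej => /leftof_cons[|[]].
    case: p fi fj fi' fj' {ei ej} => [|a p] /= _ _ fi fj.
      by apply: (fL [::]) => //; rewrite ltn_add2l.
    exact: (fL ((k + a)%N :: p)).
Qed.

(** Together with [iso_shape], this shows that the recursively computed forest is the only one
    isomorphic to [E]. *)
Lemma shape_iso T E ss : (forall v, E v -> v \in verts (btoP T)) ->
  plane_isomorphic (fverts ss) E -> shape T E = ss.
Proof.
elim: T E ss => [|l IHl r IHr] E ss ET.
  have E1 a v : E (a :: v) = false by apply/negP => /ET.
  rewrite /=; case: ifP => E0.
    by move=> /(iso_root_inv E0)[s -> /iso_empty_inv ->] // -[|a v]; rewrite /nonroot ?E1.
  by move=> /iso_empty_inv -> // -[|a v].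
have E2 a v : E (a :: v) -> (a < 2)%N by move=> /ET; rewrite cons_verts => /andP[].
rewrite /=; case: ifP => E0.
  move=> /(iso_root_inv E0)[s -> i0].
  have [//|a v /andP[_ /E2]//|s1 [s2 [-> i1 i2]]] := iso_cat_inv _ _ i0.
  congr [:: PNode (_ ++ _)]; [apply: IHl i1|apply: IHr i2];
  by move=> v /ET; rewrite cons_verts.
move=> i0; have [//|//|s1 [s2 [-> i1 i2]]] := iso_cat_inv _ _ i0.
congr (_ ++ _); [apply: IHl i1|apply: IHr i2]; by move=> v /ET; rewrite cons_verts.
Qed.

End ShapeIso.

Lemma is_embeddingP S T (E : {fset (seq nat)}) :
  is_embedding S (btoP T) E <->
  {subset E <= verts (btoP T)} /\ shape T (fun v => v \in E) = [:: S].
Proof.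
(* Prefixing addresses with 0 identifies the tree [S] with the one-tree forest [[:: S]]. *)
have lift f g (gE : forall v, g v = f (0%N :: v)) :
    plane_iso (fverts [:: S]) (fun v => v \in E) f <->
    plane_iso (fun v => v \in verts S) (fun v => v \in E) g.
  have fvE v : fverts [:: S] (0%N :: v) = (v \in verts S) by rewrite fverts_cons.
  have fv0 v : fverts [:: S] v -> exists2 w, v = 0%N :: w & w \in verts S.
    case: v => // i v; rewrite fverts_cons ltnS leqn0 => /andP[/eqP-> vS].
    by exists v.
  split=> -[fE fS fT fL]; split.
  - by move=> v vS; rewrite gE; apply: fE; rewrite fvE.
  - by move=> w /fS[_ /fv0[v -> vS] <-]; exists v.
  - by move=> u v uS vS; rewrite !gE -fT ?fvE// /tle prefix_cons eqxx.
  - by move=> p i j iS jS ij; rewrite !gE; apply: (fL (0%N :: p)) => //; rewrite fvE.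
  - by move=> _ /fv0[v -> vS]; rewrite -gE; apply: fE.
  - by move=> w /fS[v vS <-]; exists (0%N :: v); rewrite ?fvE.
  - move=> _ _ /fv0[u -> uS] /fv0[v -> vS].
    by rewrite -!gE -fT// /tle prefix_cons eqxx.
  - move=> [|a p] i j /fv0[u eu uS] /fv0[v ev vS] ij.
      by case: eu ev ij => -> _ [-> _].
    case: eu ev uS vS => -> <- [<-] uS vS; rewrite /= -!gE; exact: fL.
split=> -[ET]; last first.
  move=> sh; split=> //; have [f fi] := iso_shape ET.
  by exists (fun v => f (0%N :: v)); apply/(lift f) => //; rewrite -sh.
move=> [g giso]; split=> //; apply: shape_iso => //.
by exists (fun v => g (behead v)); apply/(lift _ g).
Qed.

(** * Enumeration of the sets of vertices of a binary tree *)

HB.instance Definition _ := gen_eqMixin ptree.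

Section VertexSets.
Local Open Scope fset_scope.

Definition node_set (b : bool) (E0 E1 : {fset (seq nat)}) : {fset (seq nat)} :=
  (if b then [fset [::]] else fset0) `|`
  ([fset (0%N :: v) | v in E0] `|` [fset (1%N :: v) | v in E1]).

Lemma nil_node_set b E0 E1 : ([::] \in node_set b E0 E1) = b.
Proof.
rewrite !inE; apply/or3P/idP => [[|/imfsetP[v _]//|/imfsetP[v _]//]|->].
  by case: b; rewrite inE.
by apply: Or31; rewrite inE.
Qed.

Lemma cons_node_set b E0 E1 a v : (a :: v \in node_set b E0 E1) =
  (a == 0%N) && (v \in E0) || (a == 1%N) && (v \in E1).
Proof.
rewrite !inE; apply/or3P/orP => [[|/imfsetP[w /= wE [-> ->]]|/imfsetP[w /= wE [-> ->]]]|].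
- by case: b; rewrite inE.
- by left.
- by right.
- move=> [/andP[/eqP-> vE]|/andP[/eqP-> vE]].
    by apply: Or32; apply/imfsetP; exists v.
  by apply: Or33; apply/imfsetP; exists v.
Qed.

Lemma node_set_inj b b' E0 E1 E0' E1' :
  node_set b E0 E1 = node_set b' E0' E1' -> [/\ b = b', E0 = E0' & E1 = E1'].
Proof.
move=> e; split; first by rewrite -(nil_node_set b E0 E1) e nil_node_set.
  apply/fsetP => v; have := cons_node_set b E0 E1 0 v.
  by rewrite e cons_node_set !eqxx /= !orbF.
apply/fsetP => v; have := cons_node_set b E0 E1 1 v.
by rewrite e cons_node_set !eqxx /=.
Qed.

(** The power set of the vertices, listed along the recursion of [shape]: a set amounts to its
    traces on both subtrees and the presence of the root. *)
Fixpoint vertex_sets (T : btree) : seq {fset (seq nat)} :=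
  match T with
  | BLeaf => [:: fset0; [fset [::]]]
  | BNode l r =>
      [seq node_set false E0 E1 | E0 <- vertex_sets l, E1 <- vertex_sets r] ++
      [seq node_set true E0 E1 | E0 <- vertex_sets l, E1 <- vertex_sets r]
  end.

Lemma mem_vertex_sets T (E : {fset (seq nat)}) :
  E \in vertex_sets T <-> {subset E <= verts (btoP T)}.
Proof.
elim: T E => [|l IHl r IHr] E.
  rewrite !inE; split=> [/orP[]/eqP-> v|ET]; rewrite ?inE//.
  apply/orP; case: (boolP ([::] \in E)) => E0; [right|left]; apply/eqP/fsetP => v.
    rewrite inE; apply/idP/eqP => [/ET|->//]; by rewrite inE => /eqP.
  by apply/negP => vE; have := ET _ vE; rewrite inE => /eqP v0; rewrite -v0 vE in E0.
rewrite mem_cat; split.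
  have H b E0 E1 : E0 \in vertex_sets l -> E1 \in vertex_sets r ->
      {subset node_set b E0 E1 <= verts (btoP (BNode l r))}.
    move=> /IHl h0 /IHr h1 [|a v]; first by rewrite nil_verts.
    rewrite cons_node_set cons_verts => /orP[]/andP[/eqP->] /=; [exact: h0|exact: h1].
  by move=> /orP[]/allpairsP[[E0 E1] /= [e0 e1 ->]]; exact: H.
move=> ET.
(* The trace of [E] on the subtree of child [a], with addresses relative to that child. *)
pose sub a : {fset (seq nat)} := [fset behead v | v in E & (v != [::]) && (head 0%N v == a)].
have subE a v : (v \in sub a) = (a :: v \in E) && (a < 2)%N.
  apply/imfsetP/andP => [[[|b w]]|[avE a2]].
  - by rewrite !inE /= andbF.
  - by rewrite !inE /= => /andP[wE /eqP <-] ->; move: (ET _ wE); rewrite cons_verts => /andP[].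
  - by exists (a :: v); rewrite // !inE /= avE eqxx.
have e : E = node_set ([::] \in E) (sub 0%N) (sub 1%N).
  apply/fsetP => -[|a v]; first by rewrite nil_node_set.
  rewrite cons_node_set !subE !andbT; apply/idP/orP => [avE|[]/andP[/eqP->]//].
  by have := ET _ avE; rewrite cons_verts => /andP[]; case: a avE => [|[|]] // -> _; [left|right].
have l0 : sub 0%N \in vertex_sets l.
  by apply/IHl => v; rewrite subE andbT => /ET; rewrite cons_verts.
have r0 : sub 1%N \in vertex_sets r.
  by apply/IHr => v; rewrite subE andbT => /ET; rewrite cons_verts.
apply/orP; rewrite {}e; case: ([::] \in E); [right|left];
  by apply/allpairsP; exists (sub 0%N, sub 1%N).
Qed.

Lemma uniq_vertex_sets T : uniq (vertex_sets T).
Proof.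
elim: T => [|l IHl r IHr].
  rewrite /= inE andbT; apply/eqP => /fsetP /(_ [::]).
  by rewrite !inE.
rewrite /= cat_uniq; apply/and3P; split.
- by apply: allpairs_uniq => // -[a b] [c d] _ _ /= /node_set_inj[_ -> ->].
- apply/hasPn => _ /allpairsP[[a b] [_ _ ->]]; apply/negP => /allpairsP[[c d] [_ _]].
  by move=> /node_set_inj[].
- by apply: allpairs_uniq => // -[a b] [c d] _ _ /= /node_set_inj[_ -> ->].
Qed.

End VertexSets.

(** * Recursive counting of embeddings *)

Definition num_shape (ss : seq ptree) (T : btree) : nat :=
  count (fun E : {fset (seq nat)} => shape T (fun v => v \in E) == ss) (vertex_sets T).

Definition num_root_shape (S : ptree) (T : btree) : nat :=
  count (fun E : {fset (seq nat)} =>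
    (shape T (fun v => v \in E) == [:: S]) && ([::] \in E)) (vertex_sets T).

Section Counting.
Local Open Scope classical_set_scope.

Lemma fsbig_count (T : choiceType) (A : set T) (p : pred T) (s : seq T) : uniq s ->
  (forall x, A x <-> x \in s /\ p x) -> \sum_(x \in A) 1%N = count p s.
Proof.
move=> us As; have -> : A = [set` [seq x <- s | p x]].
  apply/seteqP; split=> x /=; rewrite mem_filter.
    by move=> /As[-> ->].
  by move=> /andP[px xs]; apply/As.
rewrite -fsbig_seq ?filter_uniq// big_filter -sum1_count.
by [].
Qed.

Lemma num_embE S T : num_emb S (btoP T) = num_shape [:: S] T.
Proof.
apply: fsbig_count => [|E]; first exact: uniq_vertex_sets.
rewrite mem_vertex_sets /=; split=> [/is_embeddingP[ET ->]|[ET /eqP sE]] //.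
exact/is_embeddingP.
Qed.

Lemma num_good_embE S T : num_good_emb S (btoP T) = num_root_shape S T.
Proof.
apply: fsbig_count => [|E]; first exact: uniq_vertex_sets.
rewrite mem_vertex_sets /=; split=> [[/is_embeddingP[ET ->] ->]|[ET /andP[/eqP sE E0]]].
  by rewrite eqxx.
by split=> //; exact/is_embeddingP.
Qed.

(** Counts the root-free sets of shape [ss]: the first [j] trees lie in [l] and the others in
    [r]. *)
Definition split_count (ss : seq ptree) (l r : btree) : nat :=
  \sum_(j < (size ss).+1) num_shape (take j ss) l * num_shape (drop j ss) r.


(** At most one summand is nonzero, the one where [j] is the size of [s1]. *)
Lemma eq_cat_split (T : eqType) (s1 s2 s : seq T) :
  (s1 ++ s2 == s) = (\sum_(j < (size s).+1) (s1 == take j s) * (s2 == drop j s))%N :> nat.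
Proof.
have [<-|ne] := eqVneq.
  have lt : (size s1 < (size (s1 ++ s2)).+1)%N by rewrite size_cat ltnS leq_addr.
  rewrite (bigD1 (Ordinal lt))//= take_size_cat// drop_size_cat// !eqxx.
  rewrite big1 ?addn0// => j ne; case: eqP => //= e; case: eqP => //= _.
  case/eqP: ne; apply: val_inj => /=; have := congr1 size e.
  by rewrite size_takel// -ltnS ltn_ord.
rewrite big1// => j _; case: eqP => //= e1; case: eqP => //= e2.
by case/eqP: ne; rewrite e1 e2 cat_take_drop.
Qed.

Lemma sum_shape_cat ss l r :
  (\sum_(E0 <- vertex_sets l) \sum_(E1 <- vertex_sets r)
    (shape l (fun v => v \in E0) ++ shape r (fun v => v \in E1) == ss) =
  split_count ss l r)%N.
Proof.
under eq_bigr do under eq_bigr do rewrite eq_cat_split.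
under eq_bigr do rewrite exchange_big /=.
rewrite exchange_big; apply: eq_bigr => j _.
rewrite /num_shape -!sum1_count !(big_mkcond (fun E => shape _ _ == _)) /=.
rewrite big_distrlr /=; apply: eq_bigr => E0 _; apply: eq_bigr => E1 _.
by do 2!case: eqP.
Qed.

Lemma shape_node_set l r b E0 E1 :
  shape (BNode l r) (fun v => v \in node_set b E0 E1) =
  let s := shape l (fun v => v \in E0) ++ shape r (fun v => v \in E1) in
  if b then [:: PNode s] else s.
Proof.
rewrite /= nil_node_set.
have -> : (fun v => (0%N :: v) \in node_set b E0 E1) = (fun v => v \in E0).
  by apply/funext => v; rewrite cons_node_set /= orbF.
have -> : (fun v => (1%N :: v) \in node_set b E0 E1) = (fun v => v \in E1).
  by apply/funext => v; rewrite cons_node_set.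
by [].
Qed.

Lemma count_node_set b (p : pred {fset (seq nat)}) l r :
  (count p [seq node_set b E0 E1 | E0 <- vertex_sets l, E1 <- vertex_sets r] =
   \sum_(E0 <- vertex_sets l) \sum_(E1 <- vertex_sets r) p (node_set b E0 E1))%N.
Proof. by rewrite -sum1_count big_mkcond big_allpairs_dep. Qed.

Lemma num_shape_leaf ss :
  num_shape ss BLeaf = ((ss == [::]) + (ss == [:: PNode [::]]))%N.
Proof. by rewrite /num_shape /= !inE addn0 !(eq_sym ss). Qed.

(** The first term counts the sets without the root. A set with the root has a single tree as shape,
    and the rest of the set induces the forest [f] below its root. *)
Lemma num_shape_node ss l r : num_shape ss (BNode l r) =
  (split_count ss l r + if ss is [:: PNode f] then split_count f l r else 0)%N.
Proof.
rewrite /num_shape [vertex_sets _]/= count_cat !count_node_set -!sum_shape_cat.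
congr (_ + _)%N.
  apply: eq_bigr => E0 _; apply: eq_bigr => E1 _; by rewrite shape_node_set.
case: ss => [|[f] [|s ss]].
- by rewrite big1// => E0 _; rewrite big1// => E1 _; rewrite shape_node_set.
- rewrite -sum_shape_cat.
  apply: eq_bigr => E0 _; apply: eq_bigr => E1 _; rewrite shape_node_set /=.
  by congr nat_of_bool; apply/eqP/eqP => [[]|->].
- by rewrite big1// => E0 _; rewrite big1// => E1 _; rewrite shape_node_set; case: eqP.
Qed.

Lemma num_root_shape_leaf f : num_root_shape (PNode f) BLeaf = (f == [::]).
Proof.
rewrite /num_root_shape /= !inE eqxx andbT addn0 add0n eq_sym.
by congr nat_of_bool; apply/eqP/eqP => [[]|->].
Qed.

Lemma num_root_shape_node f l r :
  num_root_shape (PNode f) (BNode l r) = split_count f l r.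
Proof.
rewrite /num_root_shape [vertex_sets _]/= count_cat !count_node_set -sum_shape_cat.
rewrite [X in (X + _)%N]big1 ?add0n => [|E0 _]; last first.
  by apply: big1 => E1 _; rewrite nil_node_set andbF.
apply: eq_bigr => E0 _; apply: eq_bigr => E1 _.
rewrite shape_node_set nil_node_set andbT /=.
by congr nat_of_bool; apply/eqP/eqP => [[]|->].
Qed.

(** * Enumeration of binary trees by internal nodes *)

Fixpoint bnodes (T : btree) : nat :=
  if T is BNode l r then (bnodes l + bnodes r).+1 else 0.

Lemma bsizeE T : bsize T = (2 * bnodes T + 1)%N.
Proof. by elim: T => //= l -> r ->; lia. Qed.

(** The sizes [i] and [k - i] are not structural subterms of [k.+1], so the recursion is on a bound
    [d]; the list is complete as soon as [k <= d]. *)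
Fixpoint btrees_fuel (d k : nat) : seq btree :=
  match d, k with
  | _, 0 => [:: BLeaf]
  | 0, _ => [::]
  | d.+1, k.+1 => flatten [seq [seq BNode l r | l <- btrees_fuel d i,
                                                r <- btrees_fuel d (k - i)]
                          | i <- iota 0 k.+1]
  end.

Lemma btrees_fuelS d k : btrees_fuel d.+1 k.+1 =
  flatten [seq [seq BNode l r | l <- btrees_fuel d i, r <- btrees_fuel d (k - i)]
          | i <- iota 0 k.+1].
Proof. by []. Qed.

Lemma mem_btrees_fuel d k T : (k <= d)%N -> (T \in btrees_fuel d k) = (bnodes T == k).
Proof.
elim: d k T => [|d IH] [|k] T //; try by case: T.
rewrite ltnS => kd; apply/flatten_mapP/eqP => [[i]|].
  rewrite mem_iota /= ltnS => ik /allpairsP[[l r] /= []].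
  rewrite !IH ?(leq_trans (leq_subr _ _))// ?(leq_trans ik)// => /eqP hl /eqP hr ->.
  by rewrite /= hl hr subnKC.
case: T => // l r [e]; exists (bnodes l).
  by rewrite mem_iota /= -e; lia.
apply/allpairsP; exists (l, r); rewrite !IH /=; try lia.
by split=> //; rewrite -e addKn.
Qed.

Lemma uniq_btrees_fuel d k : (k <= d)%N -> uniq (btrees_fuel d k).
Proof.
elim: d k => [|d IH] [|k] // kd; rewrite ltnS in kd.
rewrite btrees_fuelS.
have : {subset iota 0 k.+1 <= [pred i | (i <= k)%N]}.
  by move=> i; rewrite mem_iota.
have := iota_uniq 0 k.+1; elim: (iota _ _) => //= i s IHs /andP[is_ us] sub.
have ik : (i <= k)%N by apply: sub; rewrite mem_head.
rewrite cat_uniq IHs// ?andbT; last by move=> j js; apply: sub; rewrite inE js orbT.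
apply/andP; split.
  apply: allpairs_uniq; [apply: IH|apply: IH|]; try lia.
  by move=> [a b] [a' b'] _ _ /= [-> ->].
apply/hasPn => T /flatten_mapP[j js /allpairsP[[l r] /= [+ _ ->]]].
have jk : (j <= k)%N by apply: sub; rewrite inE js orbT.
rewrite mem_btrees_fuel ?(leq_trans jk)// => /eqP lj.
apply/negP => /allpairsP[[l' r'] /= [+ _ [e _]]].
rewrite -e mem_btrees_fuel ?(leq_trans ik)// => /eqP li.
by move: is_; rewrite -li lj js.
Qed.

Definition btrees k := btrees_fuel k k.

Lemma sum_btreesS k (F : btree -> nat) :
  (\sum_(T <- btrees k.+1) F T =
   \sum_(i < k.+1) \sum_(l <- btrees i) \sum_(r <- btrees (k - i)) F (BNode l r))%N.
Proof.
have P d j : (j <= d)%N -> perm_eq (btrees_fuel d j) (btrees j).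
  move=> jd; apply: uniq_perm; rewrite ?uniq_btrees_fuel// => T.
  by rewrite /btrees !mem_btrees_fuel.
rewrite {1}/btrees btrees_fuelS big_flatten big_map.
rewrite -(big_mkord xpredT (fun i => \sum_(l <- btrees i) \sum_(r <- btrees (k - i)) F (BNode l r)))%N.
rewrite /index_iota subn0; apply: eq_big_seq => i; rewrite mem_iota /= ltnS => ik.
rewrite big_allpairs_dep (perm_big _ (P _ _ ik)); apply: eq_bigr => l _.
by rewrite (perm_big _ (P _ _ (leq_subr _ _))).
Qed.

Lemma sum_bsize k (F G : btree -> nat) : F =1 G ->
  (\sum_(T \in [set T : btree | bsize T = (2 * k + 1)%N]) F T = \sum_(T <- btrees k) G T)%N.
Proof.
move=> FG; have -> : [set T : btree | bsize T = (2 * k + 1)%N] = [set` btrees k].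
  apply/seteqP; split=> T /=; rewrite mem_btrees_fuel// bsizeE; first by move=> e; lia.
  by move=> /eqP->.
by rewrite -fsbig_seq ?uniq_btrees_fuel//; apply: eq_bigr.
Qed.

Lemma aBE k S : aB (2 * k + 1) S = (\sum_(T <- btrees k) num_shape [:: S] T)%N.
Proof. by apply: sum_bsize => T; exact: num_embE. Qed.

Lemma gBE k S : gB (2 * k + 1) S = (\sum_(T <- btrees k) num_root_shape S T)%N.
Proof. by apply: sum_bsize => T; exact: num_good_embE. Qed.

End Counting.

(** * Generating functions of the embedding counts *)

Lemma ptree_mem_ind (P : ptree -> Prop) :
  (forall ts, (forall s, s \in ts -> P s) -> P (PNode ts)) -> forall t, P t.
Proof.
(* The recursion passes through the list of children, hence a direct fixpoint with an inner
   induction on that list. *)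
move=> H; fix IH 1; case=> ts; apply: H; elim: ts => [|a l IHl] s.
  by clear IH; rewrite in_nil.
by rewrite inE => /predU1P[->|]; [exact: IH|exact: IHl].
Qed.

(* Number of edges plus number of leaves minus one. *)
Fixpoint weight (t : ptree) : nat :=
  let: PNode ts := t in ((size ts).-1 + sumn (map (fun s => (weight s).+1) ts))%N.

Section GeneratingFunctions.
Variable R : numFieldType.

(** For the empty forest only the empty set counts, so [shape_gf [::]] is the series of all binary
    trees. *)
Definition shape_gf (ss : seq ptree) : fps R :=
  Fps (fun k => (\sum_(T <- btrees k) num_shape ss T)%:R).
Definition root_gf (S : ptree) : fps R :=
  Fps (fun k => (\sum_(T <- btrees k) num_root_shape S T)%:R).
Definition split_gf (ss : seq ptree) : fps R :=
  \sum_(j < (size ss).+1) shape_gf (take j ss) * shape_gf (drop j ss).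

Local Notation F := shape_gf.
Local Notation G := root_gf.
Local Notation X := (fpsX R).
Local Notation B := (F [::]).
Local Notation D := (sqpow (-1 : R)).

Lemma fcoef_split_gf ss k : fcoef (split_gf ss) k =
  (\sum_(i < k.+1) \sum_(l <- btrees i) \sum_(r <- btrees (k - i)) split_count ss l r)%:R.
Proof.
rewrite fcoef_sum; under eq_bigr do rewrite fcoefM.
rewrite exchange_big natr_sum; apply: eq_bigr => i _.
under [in RHS]eq_bigr do rewrite exchange_big.
rewrite exchange_big natr_sum; apply: eq_bigr => j _.
by rewrite /= -natrM big_distrlr.
Qed.

Lemma fcoef_nat n k : fcoef (n%:R : fps R) k = (if k == 0 then n else 0)%:R.
Proof. by rewrite fcoefMn fcoef1; case: eqP; rewrite ?mul0rn. Qed.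

Lemma shape_gfE ss : F ss = ((ss == [::]) + (ss == [:: PNode [::]]))%:R +
  X * (split_gf ss + if ss is [:: PNode f] then split_gf f else 0).
Proof.
apply: fpsP => -[|k]; rewrite fcoefD fcoef_nat ?fcoefXM0 ?fcoefXMS /=.
  by rewrite /btrees /= big_seq1 num_shape_leaf addr0.
rewrite sum_btreesS add0r fcoef_split_gf.
under eq_bigr do under eq_bigr do under eq_bigr do rewrite num_shape_node.
under eq_bigr do under eq_bigr do rewrite big_split /=.
under eq_bigr do rewrite big_split /=.
rewrite big_split natrD /=; congr (_ + _).
case: ss => [|[f] [|s ss]]; rewrite ?fcoef_split_gf//.
all: by rewrite big1// => i _; rewrite big1// => l _; rewrite big1.
Qed.

Lemma root_gfE f : G (PNode f) = (f == [::])%:R + X * split_gf f.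
Proof.
apply: fpsP => -[|k]; rewrite fcoefD fcoef_nat ?fcoefXM0 ?fcoefXMS /=.
  by rewrite /btrees /= big_seq1 num_root_shape_leaf addr0.
rewrite sum_btreesS add0r fcoef_split_gf.
by under eq_bigr do under eq_bigr do under eq_bigr do rewrite num_root_shape_node.
Qed.

Lemma split_gf0 : split_gf [::] = B * B.
Proof. by rewrite /split_gf big_ord_recl big_ord0 addr0. Qed.

Lemma split_gf1 s : split_gf [:: s] = 2 * B * F [:: s].
Proof. by rewrite /split_gf !big_ord_recl big_ord0 /=; ring. Qed.

Lemma tree_gfE : B = 1 + X * (B * B).
Proof. by rewrite {1}shape_gfE addr0 split_gf0. Qed.

(* Both sides are square roots of [1 - 4 X] with constant term [1]. *)
Lemma sqrt_gfE : D = 1 - 2 * X * B.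
Proof.
apply/esym/eqP; rewrite -subr_eq0; apply/eqP.
apply: (@fps_mulf_eq0 _ (1 - 2 * X * B + D)).
  rewrite fcoefD sqpow_coef0 fcoefB fcoef1 -mulrA mulrCA fcoefXM0 subr0.
  by rewrite (_ : _ + 1 = 2) ?pnatr_eq0//; ring.
have e := tree_gfE; have := sqpowD (-1 : R) (-1).
have -> : -1 + -1 = - 2 :> R by ring.
rewrite sqpow_N2 => d2.
have -> : (1 - 2 * X * B + D) * (1 - 2 * X * B - D) =
  1 - 4 * X * B + 4 * X * (X * (B * B)) - D * D by ring.
have -> : X * (B * B) = B - 1 by rewrite {3}e; ring.
by rewrite d2; ring.
Qed.

(** An embedding that avoids the root lies in one of the two subtrees, the other being arbitrary:
    [F = G + 2 X B F], and [1 - 2 X B = D]. *)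
Lemma sqrt_mul_gf S : D * F [:: S] = G S.
Proof.
case: S => f; rewrite sqrt_gfE root_gfE mulrBl mul1r {1}shape_gfE split_gf1.
have -> : ([:: PNode f] == [:: PNode [::]]) = (f == [::]).
  by apply/eqP/eqP => [[]|->].
by rewrite add0n; ring.
Qed.

Lemma shape_gf_single S : F [:: S] = sqpow 1 * G S.
Proof. by rewrite -sqrt_mul_gf mulrA sqpowD subrr sqpow0 mul1r. Qed.

Lemma root_gf_leaf : G (PNode [::]) = B.
Proof. by rewrite root_gfE split_gf0 -tree_gfE. Qed.

Lemma root_gf_unary s : G (PNode [:: s]) = (1 - D) * F [:: s].
Proof. by rewrite root_gfE split_gf1 sqrt_gfE add0r; ring. Qed.

(** Removing the root is a bijection onto the sets of shape [f], since a set inducing at least two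
    trees cannot contain the root. *)
Lemma root_gf_forest f : (1 < size f)%N -> G (PNode f) = F f.
Proof.
case: f => [|[s] [|s' f]] // _; rewrite root_gfE shape_gfE addr0.
by have /eqP/negPf -> : [:: PNode s, s' & f] <> [:: PNode [::]] by [].
Qed.

(** The two extreme splits, with all trees on one side, each give [B * F ss]; moved to the left they
    form the factor [1 - 2 X B = D]. *)
Lemma forest_gf_rec d ss : size ss = d.+2 ->
  D * F ss = X * \sum_(j < d.+1) F (take j.+1 ss) * F (drop j.+1 ss).
Proof.
move=> sz; rewrite sqrt_gfE mulrBl mul1r {1}shape_gfE.
have -> : (ss == [::]) = false by case: (ss) sz.
have -> : (ss == [:: PNode [::]]) = false by apply/eqP => e; rewrite e in sz.
have -> : (if ss is [:: PNode f] then split_gf f else 0) = 0.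
  by case: (ss) sz => [|[?] []].
rewrite /split_gf sz big_ord_recl big_ord_recr /= take0 drop0.
have tE : take d.+2 ss = ss by rewrite -sz take_size.
have dE : drop d.+2 ss = [::] by rewrite -sz drop_size.
rewrite /bump /= !add1n tE dE.
by set s := \sum_(_ < _) _; ring.
Qed.

(* [K d] is the [d]-th Catalan number. *)
Lemma forest_gf d : exists2 K : R, 0 < K & forall ss, size ss = d.+1 ->
  F ss = fpsC K * (X * sqpow 1) ^+ d * \prod_(s <- ss) F [:: s].
Proof.
elim/ltn_ind: d => -[|d] IH.
  exists 1 => // -[|s [|]] // _.
  by rewrite big_seq1 expr0 !mul1r.
(* The induction hypothesis is turned into a sequence of constants, with the value 1 out of
   range. *)
have /choice[K KP] : forall e, exists K : R, (e < d.+1)%N -> 0 < K /\ forall ss,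
    size ss = e.+1 -> F ss = fpsC K * (X * sqpow 1) ^+ e * \prod_(s <- ss) F [:: s].
  move=> e; case: (ltnP e d.+1) => [/IH[K K0 KP]|_]; first by exists K.
  by exists 1.
(* Catalan recurrence: [j + 1] trees go left and [d - j + 1] go right. *)
exists (\sum_(j < d.+1) K j * K (d - j)%N).
  rewrite big_ord_recl ltr_pwDl ?sumr_ge0// ?subn0.
    by rewrite mulr_gt0// (proj1 (KP _ _)).
  by move=> i _; rewrite mulr_ge0// ltW// (proj1 (KP _ _))//; lia.
move=> ss sz.
have -> : F ss = sqpow 1 * (D * F ss) by rewrite mulrA sqpowD subrr sqpow0 mul1r.
rewrite (forest_gf_rec sz).
have -> : fpsC (\sum_(j < d.+1) K j * K (d - j)%N) = \sum_(j < d.+1) fpsC (K j * K (d - j)%N).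
  by apply: (big_morph (@fpsC R)); [exact: fpsCD|exact: fpsC0].
set A := \sum_(_ < _) fpsC _; set Q := \prod_(_ <- _) _.
suff -> : \sum_(j < d.+1) F (take j.+1 ss) * F (drop j.+1 ss) = A * (X * sqpow 1) ^+ d * Q.
  by rewrite exprS; ring.
rewrite /A /Q -mulrA mulr_suml; apply: eq_bigr => j _.
have jd := ltn_ord j.
rewrite (proj2 (KP j jd)); last by rewrite size_takel// sz; lia.
rewrite (proj2 (KP (d - j)%N _)); [|lia|by rewrite size_drop sz; lia].
rewrite -[in RHS](cat_take_drop j.+1 ss) big_cat /= fpsCM.
have -> : (X * sqpow 1) ^+ d = (X * sqpow 1) ^+ j * (X * sqpow 1) ^+ (d - j).
  by rewrite -exprD subnKC// -ltnS.
ring.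
Qed.

(** By induction, the product of the [X * F [:: s]] over the children has this form with exponent
    the sum of the [weight s + 1]. A leaf gives [(1 - D) / 2], an only child adds a factor [1 - D],
    and [m > 1] children add [m - 1] to the exponent by [forest_gf]. *)
Lemma root_gf_closed S : exists (C : R) (u : nat), C != 0 /\
  X * G S = fpsC C * ((1 - D) ^+ u * sqpow (weight S)%:R).
Proof.
elim/ptree_mem_ind: S => f IH.
have IHF s : s \in f -> exists (C : R) (u : nat), C != 0 /\
    X * F [:: s] = fpsC C * ((1 - D) ^+ u * sqpow (weight s).+1%:R).
  move=> /IH[C [u [C0 e]]]; exists C, u; split=> //.
  by rewrite shape_gf_single mulrCA e -natr1 addrC -sqpowD; ring.
have prodE : exists (C : R) (u : nat), C != 0 /\ \prod_(s <- f) (X * F [:: s]) =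
    fpsC C * ((1 - D) ^+ u * sqpow (sumn (map (fun s => (weight s).+1) f))%:R).
  elim: f IHF {IH} => [|s f IHf] H.
    by exists 1, 0; split; rewrite ?oner_neq0// big_nil sqpow0 expr0 !mul1r.
  have [|C [u [C0 e]]] := IHf; first by move=> s' s'f; apply: H; rewrite inE s'f orbT.
  have [|C' [u' [C0' e']]] := H s; first by rewrite mem_head.
  exists (C' * C), (u' + u)%N; split; first by rewrite mulf_neq0.
  by rewrite big_cons e e' /= natrD -sqpowD fpsCM exprD; ring.
have [C [u [C0 e]]] := prodE.
case: f {IH IHF prodE} e => [|s [|s' f]] e.
- exists (2^-1), 1; split; first by rewrite invr_eq0 pnatr_eq0.
  rewrite root_gf_leaf sqpow0 mulr1 expr1 sqrt_gfE opprB addrCA subrr addr0.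
  have -> : 2 * X * B = fpsC 2 * (X * B) by rewrite [fpsC 2]fpsCD !fpsC1; ring.
  by rewrite mulrA -fpsCM mulVf ?pnatr_eq0// mul1r.
- exists C, u.+1; split=> //; move: e; rewrite big_seq1 root_gf_unary => e.
  by rewrite mulrCA e exprS /= addn0 add0n; ring.
- have [K K0 KP] := forest_gf (size f).+1.
  exists (K * C), u; split; first by rewrite mulf_neq0// lt0r_neq0.
  rewrite root_gf_forest// (KP [:: s, s' & f])//.
  (* The leading [X] and the [(size f).+1] ones from [forest_gf] supply one [X] for each of the
     [(size f).+2] children. *)
  have -> : X * (fpsC K * (X * sqpow 1) ^+ (size f).+1 * \prod_(i <- [:: s, s' & f]) F [:: i]) =
      fpsC K * sqpow 1 ^+ (size f).+1 * \prod_(i <- [:: s, s' & f]) (X * F [:: i]).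
    rewrite big_split exprMn big_const_seq count_predT iter_mulr mulr1.
    by rewrite (exprS X (size f).+1) /=; ring.
  rewrite sqpow1X.
  by rewrite e fpsCM [weight _]/= natrD -sqpowD; ring.
Qed.

End GeneratingFunctions.

(** * Monotonicity of the weight *)

Definition leafb (S : ptree) (v : seq nat) : bool := rcons v 0 \notin verts S.

Lemma uniq_verts S : uniq (verts S).
Proof.
elim/ptree_mem_ind: S => ts IH; rewrite vertsE cons_uniq; apply/andP; split.
  by apply/negP => /allpairsPdep[i [v []]].
apply: allpairs_uniq_dep; first exact: iota_uniq.
  by move=> i; rewrite mem_iota => /andP[_ ilt]; apply: IH; rewrite mem_nth.
by move=> [i v] [j w] _ _ /= [-> ->].
Qed.

Lemma sum_nth (g : ptree -> nat) ts :
  (\sum_(i <- iota 0 (size ts)) g (nth (PNode [::]) ts i) = sumn (map g ts))%N.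
Proof.
by rewrite sumnE big_map (big_nth (PNode [::])) /index_iota subn0.
Qed.

(** A tree has one edge fewer than vertices. This form is suited to embeddings, which act on
    vertices and not on edges. *)
Lemma weight_verts S :
  (weight S + 2 = size (verts S) + count (leafb S) (verts S))%N.
Proof.
elim/ptree_mem_ind: S => ts IH.
have szE : size (verts (PNode ts)) = (sumn (map (size \o verts) ts)).+1.
  rewrite vertsE /= size_allpairs_dep sumnE big_map.
  by congr _.+1; rewrite -sum_nth.
have ctE : count (leafb (PNode ts)) (verts (PNode ts)) =
    ((ts == [::]) + sumn (map (fun s => count (leafb s) (verts s)) ts))%N.
  rewrite vertsE /=; congr (_ + _)%N.
    by rewrite /leafb /= cons_verts nil_verts andbT lt0n size_eq0 negbK.
  rewrite count_flatten -map_comp sumnE big_map -sum_nth.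
  rewrite !big_seq; apply: eq_bigr => i; rewrite mem_iota /= add0n => ilt.
  rewrite count_map; apply: eq_count => v.
  by rewrite /leafb /= cons_verts ilt.
rewrite szE ctE /=; case: ts IH {szE ctE} => [|s ts] IH //.
have : (sumn [seq (weight i).+1 | i <- s :: ts] + size (s :: ts) =
    sumn (map (size \o verts) (s :: ts)) +
    sumn [seq count (leafb t) (verts t) | t <- s :: ts])%N.
  elim: (s :: ts) IH => //= a l IHl H.
  have := H a (mem_head _ _); have := IHl (fun x xl => H x (mem_behead (s := a :: l) xl)).
  lia.
have -> : (s :: ts == [::]) = false by [].
rewrite [size (s :: ts)]/= [_.-1]/=; lia.
Qed.

Lemma prefix_anti (u v : seq nat) : prefix u v -> prefix v u -> u = v.
Proof.
move=> /prefixP[s ->] /prefixP[t e]; have := congr1 size e; rewrite !size_cat.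
by case: s {e} => [|x s] /=; [rewrite cats0|lia].
Qed.

Lemma prefix_comparable (a b w : seq nat) :
  prefix a w -> prefix b w -> prefix a b || prefix b a.
Proof.
elim: a b w => [|x a IH] [|y b] [|z w] //=; rewrite ?prefix0s ?orbT//.
move=> /andP[/eqP-> pa] /andP[/eqP-> pb].
by rewrite eqxx; exact: IH pa pb.
Qed.

Lemma leafb_max S v w : v \in verts S -> leafb S v -> w \in verts S ->
  prefix v w -> v = w.
Proof.
elim/ptree_mem_ind: S v w => ts IH [|a v] [|b w] //.
  move=> _; rewrite /leafb /= !cons_verts nil_verts andbT => h /andP[blt].
  by rewrite (leq_ltn_trans _ blt) in h.
rewrite /leafb /= !cons_verts => /andP[alt vV] lv /andP[_ wV].
rewrite alt /= in lv.
move=> /andP[/eqP ab pvw]; rewrite -ab in wV *; congr (_ :: _).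
exact: (IH _ (mem_nth (PNode [::]) alt)).
Qed.

Lemma leafb_below S v : v \in verts S ->
  exists w, [/\ w \in verts S, leafb S w & prefix v w].
Proof.
elim/ptree_mem_ind: S v => ts IH [|i v].
  case: ts IH => [|s ts] IH _; first by exists [::]; rewrite nil_verts.
  have [w [wV lw _]] := IH s (mem_head _ _) _ (nil_verts s).
  by exists (0%N :: w); rewrite /leafb rcons_cons !cons_verts wV.
rewrite cons_verts => /andP[ilt vV].
have [w [wV lw vw]] := IH _ (mem_nth _ ilt) _ vV.
by exists (i :: w); rewrite /leafb rcons_cons !cons_verts wV ilt prefix_cons eqxx.
Qed.

(* Both numbers of vertices and of leaves are monotone: distinct leaves of [S1]
   have incomparable images, below which lie distinct leaves of [S2]. *)
Lemma weight_subtree S1 S2 : subtree S1 S2 -> (weight S1 <= weight S2)%N.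
Proof.
move=> [E [ES [f [fE _ fT _]]]].
have fV v : v \in verts S1 -> f v \in verts S2 by move=> /fE /ES.
have f_inj : {in verts S1 &, injective f}.
  move=> u v uS vS fuv; apply: prefix_anti.
    by have := fT _ _ vS uS; rewrite /tle fuv prefix_refl.
  by have := fT _ _ uS vS; rewrite /tle fuv prefix_refl.
rewrite -(leq_add2r 2) !weight_verts leq_add//.
  rewrite -(size_map f); apply: uniq_leq_size; first by rewrite map_inj_in_uniq ?uniq_verts.
  by move=> _ /mapP[v vS ->]; exact: fV.
(* [g v] is a chosen leaf of [S2] below the image of [v]. *)
have /choice[g gP] : forall v, exists w, v \in verts S1 ->
    [/\ w \in verts S2, leafb S2 w & prefix (f v) w].
  move=> v; case: (boolP (v \in verts S1)) => [/fV/leafb_below[w ?]|]; first by exists w.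
  by exists [::].
rewrite -!size_filter -(size_map g); apply: uniq_leq_size.
  rewrite map_inj_in_uniq ?filter_uniq ?uniq_verts// => u v.
  rewrite !mem_filter => /andP[lu uS] /andP[lv vS] guv.
  have [_ _ pu] := gP _ uS; have [_ _ pv] := gP _ vS; rewrite -guv in pv.
  (* Images above a common leaf are comparable, hence so are the leaves [u] and [v] of [S1], which
     must then coincide. *)
  have /orP[] := prefix_comparable pu pv.
    by rewrite -/(tle (f v) (f u)) -fT// => /(leafb_max uS lu vS).
  by rewrite -/(tle (f u) (f v)) -fT// => /(leafb_max vS lv uS).
move=> _ /mapP[v + ->]; rewrite mem_filter => /andP[_ /gP[gV lg _]].
by rewrite mem_filter lg.
Qed.

(** * Limits of the ratios and their comparison *)

Local Open Scope classical_set_scope.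
Local Open Scope ring_scope.

(** Both counts are coefficients [k.+1] in the closed forms, with the same [C] and [u]; [C] cancels,
    and passing from good to all embeddings divides by [D], which raises the exponent by one. *)
Lemma ratio_seq_cvg (R : realType) (S : ptree) (l : R) :
  Num.sqrt k.+1%:R * (fcoef (sqpow (weight S)%:R) k.+1 /
    fcoef (sqpow (weight S).+1%:R) k.+1) @[k --> \oo] --> l ->
  ratio_seq R S @ \oo --> Num.sqrt 2 * l.
Proof.
move=> lP; have [C [u [C0 e]]] := root_gf_closed R S.
rewrite [X in X @ _](_ : _ = fun k => Num.sqrt (2 * k + 1)%N%:R *
   (fcoef ((1 - sqpow (-1)) ^+ u * sqpow (weight S)%:R) k.+1 /
    fcoef ((1 - sqpow (-1)) ^+ u * sqpow (weight S).+1%:R) k.+1)).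
  exact: comb_ratio_cvg.
apply/funext => k; rewrite /ratio_seq; congr (_ * _).
have -> : (gB (2 * k + 1) S)%:R = fcoef (fpsX R * root_gf R S) k.+1.
  by rewrite fcoefXMS gBE.
have -> : (aB (2 * k + 1) S)%:R = fcoef (fpsX R * shape_gf R [:: S]) k.+1.
  by rewrite fcoefXMS aBE.
have -> : fpsX R * shape_gf R [:: S] =
    fpsC C * ((1 - sqpow (-1)) ^+ u * sqpow (weight S).+1%:R).
  by rewrite shape_gf_single mulrCA e -natr1 [_ + 1]addrC -sqpowD; ring.
by rewrite e !fcoefCM -mulf_div divff// mul1r.
Qed.

Theorem theorem3 (R : realType) (S1 S2 : ptree) :
  subtree S1 S2 ->
  exists l1 l2 : R,
    [/\ ratio_seq R S1 @ \oo --> l1, ratio_seq R S2 @ \oo --> l2 & l1 <= l2].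
Proof.
move=> /weight_subtree w12.
have [l1 l1P] := sqpow_ratio_cvg R (weight S1).
have [l2 l2P] := sqpow_ratio_cvg R (weight S2).
exists (Num.sqrt 2 * l1), (Num.sqrt 2 * l2).
split; [exact: ratio_seq_cvg|exact: ratio_seq_cvg|].
by rewrite ler_wpM2l ?sqrtr_ge0// (sqpow_ratio_lim_le w12 l1P l2P).
Qed.
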